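(* Let $d\geq1$ and fix $\epsilon\in(0,1)$, $\ell>0$ and $\beta>0$. Let $Q_t$ denote the space-time region $(-t^2,t^2)^d\times[0,t/2)$. Then there exist a positive constant $c=c(d)$, a positive value $C$, and values $\lambda_0,t_0>0$ such that for all $\lambda>\lambda_0$ and $t>t_0$, $$\Pr\big[\exists\text{ a cell of } K(\mathbf{0},0)\text{ whose region is not contained in } Q_t\big]\leq\begin{cases}\exp\left(-C\frac{\sqrt t}{(\log t)^c}\right)& d=1,\\ \exp\left(-C\frac{t}{(\log t)^c}\right)& d=2,\\ \exp(-Ct)& d\geq3.\end{cases}$$
   Context: Let $\Pi_0$ be a Poisson point process on $\mathbb{R}^d$ of intensity $\lambda$ (points called nodes); each node moves as an independent standard Brownian motion, and $\Pi_s$ denotes the set of node positions at time $s\geq0$. Tessellate $\mathbb{R}^d$ into cubes of side $\ell$: for $\mathbf i=(i_1,\dots,i_d)\in\mathbb{Z}^d$ the cube $\mathbf i$ is $\prod_{j=1}^d[i_j\ell,(i_j+1)\ell]$. For $\tau\in\mathbb{Z}_{\geq0}$ the time interval $\tau$ is $[\tau\beta,(\tau+1)\beta]$. A cell is a pair $(\mathbf i,\tau)\in\mathbb{Z}^d\times\mathbb{Z}_{\geq0}$, with region (cube $\mathbf i$)$\times[\tau\beta,(\tau+1)\beta]$. Let $E(\mathbf i,\tau)$ be the indicator that $\Pi_{\tau\beta}$ contains at least $(1-\epsilon)\lambda\ell^d$ nodes in cube $\mathbf i$. Two distinct cells $(\mathbf i,\tau),(\mathbf i',\tau')$ are adjacent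 if $\|\mathbf i-\mathbf i'\|_\infty\leq1$ and $|\tau-\tau'|\leq1$. A cell is bad if $E(\mathbf i,\tau)=0$. If $(\mathbf{0},0)$ is bad, $K(\mathbf 0,0)$ is the set of bad cells reachable from $(\mathbf 0,0)$ by a path of pairwise adjacent bad cells (including $(\mathbf 0,0)$); otherwise $K(\mathbf 0,0)=\emptyset$. *)

(* Defs.v *)
From HB Require Import structures.
From mathcomp Require Import all_boot all_order all_algebra.
From mathcomp Require Import all_classical all_reals all_analysis.
Set Implicit Arguments. Unset Strict Implicit. Unset Printing Implicit Defensive.
Import Order.TTheory GRing.Theory Num.Theory numFieldNormedType.Exports.
Local Open Scope classical_set_scope.
Local Open Scope ring_scope.

Section Model.
Context {R : realType} {dT : measure_display} {T : measurableType dT}.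
Variable (P : probability T R).

Definition mutually_independent (I : eqType) (F : I -> set (set T)) : Prop :=
  forall (J : seq I) (A : I -> set T), uniq J ->
    (forall i, i \in J -> F i (A i)) ->
    P (\bigcap_(i in [set` J]) A i) = (\prod_(i <- J) P (A i))%E.

Definition rv_sigma (I : Type) (Y : I -> T -> R) : set (set T) :=
  <<s [set E | exists i B, measurable B /\ E = Y i @^-1` B] >>.

Definition standard_BM (W : R -> T -> R) : Prop :=
  (forall s, 0 <= s -> measurable_fun setT (W s)) /\
  (forall w, W 0 w = 0) /\
  (forall w, {within [set s : R | 0 <= s], continuous (fun s => W s w)}) /\
  (forall (n : nat) (t : nat -> R) (B : nat -> set R),
     0 <= t 0%N -> (forall i, (i < n)%N -> t i < t i.+1) ->
     (forall i, (i < n)%N -> measurable (B i)) ->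
     P (\bigcap_(i in [set i | (i < n)%N]) [set w | B i (W (t i.+1) w - W (t i) w)])
     = (\prod_(i < n) normal_prob 0 (Num.sqrt (t i.+1 - t i)) (B i))%E).

Definition box (d : nat) (a b : 'I_d -> R) : set ('I_d -> R) :=
  [set x | forall j, a j <= x j < b j].

Definition count_eq (d : nat) (X : nat -> 'I_d -> T -> R)
    (A : set ('I_d -> R)) (n : nat) : set T :=
  [set w | exists s : seq nat, [/\ uniq s, size s = n &
      forall k, A (fun j => X k j w) <-> k \in s]].

Definition poisson_point_process (d : nat) (lam : R)
    (X : nat -> 'I_d -> T -> R) : Prop :=
  (forall k j, measurable_fun setT (X k j)) /\
  forall (m : nat) (a b : 'I_m -> 'I_d -> R) (n : 'I_m -> nat),
    (forall p j, a p j < b p j) ->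
    (forall p q, p != q -> box (a p) (b p) `&` box (a q) (b q) = set0) ->
    P (\bigcap_(p in [set: 'I_m]) count_eq X (box (a p) (b p)) (n p))
    = (\prod_(p < m) (poisson_pmf (lam * \prod_(j < d) (b p j - a p j)) (n p))%:E)%E.

(* Poisson point process of intensity lam with nodes performing independent
   standard Brownian motions: node k is at X k + W k s at time s *)
Definition PPP_BM (d : nat) (lam : R) (X : nat -> 'I_d -> T -> R)
    (W : nat -> 'I_d -> R -> T -> R) : Prop :=
  [/\ poisson_point_process lam X,
      (forall k j, standard_BM (W k j)) &
      mutually_independent
        (fun o : option (nat * 'I_d) => match o with
          | None => rv_sigma (fun kj : nat * 'I_d => X kj.1 kj.2)
          | Some kj => rv_sigma (fun s : {s : R | 0 <= s} => W kj.1 kj.2 (sval s))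
          end)].

End Model.

Section Cells.
Context {R : realType} {T : Type}.
Variables (d : nat) (eps lam ell beta : R)
  (X : nat -> 'I_d -> T -> R) (W : nat -> 'I_d -> R -> T -> R).

Definition cell := (('I_d -> int) * nat)%type.

Definition position (k : nat) (s : R) (w : T) : 'I_d -> R :=
  fun j => X k j w + W k j s w.

Definition cube (i : 'I_d -> int) : set ('I_d -> R) :=
  [set x | forall j, (i j)%:~R * ell <= x j <= (i j + 1)%:~R * ell].

Definition E_good (c : cell) (w : T) : Prop :=
  exists s : seq nat, [/\ uniq s,
    forall k, k \in s -> cube c.1 (position k (c.2%:R * beta) w) &
    (1 - eps) * lam * ell ^+ d <= (size s)%:R].

Definition bad (c : cell) (w : T) : Prop := ~ E_good c w.

Definition adjacent (c c' : cell) : Prop :=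
  c <> c' /\ (forall j, `|c.1 j - c'.1 j| <= 1) /\ `|(c.2%:Z - c'.2%:Z)%R| <= 1.

Definition cell0 : cell := (fun _ => 0, 0%N).

Inductive K00 (w : T) : cell -> Prop :=
  | K00_base : bad cell0 w -> K00 w cell0
  | K00_step c c' : K00 w c -> adjacent c c' -> bad c' w -> K00 w c'.

Definition region (c : cell) : set (('I_d -> R) * R) :=
  [set p | cube c.1 p.1 /\ c.2%:R * beta <= p.2 <= (c.2.+1)%:R * beta].

Definition Q (t : R) : set (('I_d -> R) * R) :=
  [set p | (forall j, - t ^+ 2 < p.1 j < t ^+ 2) /\ 0 <= p.2 < t / 2].

Definition escape_event (t : R) : set T :=
  [set w | exists c, K00 w c /\ ~ (region c `<=` Q t)].

End Cells.

(* Main.v *)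
Require Import Defs.
From HB Require Import structures.
From mathcomp Require Import all_boot all_order all_algebra.
From mathcomp Require Import all_classical all_reals all_analysis.
From mathcomp Require Import measurable_realfun zify ring lra.
(* [adjacent] is also the name of a lemma of MathComp-Analysis. *)
Import Defs.
Set Implicit Arguments. Unset Strict Implicit. Unset Printing Implicit Defensive.
Import Order.TTheory GRing.Theory Num.Theory numFieldNormedType.Exports.
Local Open Scope classical_set_scope.
Local Open Scope ring_scope.

(** A bad path leaving the box is reduced to a tree-like skeleton of [2 ^ k] of
    its cells: from a path of radius [2 * L + g] one keeps a skeleton of radius
    [L] around its starting point and one that starts at the last exit from the
    ball of radius [L + g]; the halves are at distance more than [g], and there
    are only exponentially many (in [2 ^ k]) skeletons.  If all cells of a
    skeleton are bad then the total number of visits of nodes to its cells is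
    atypically small.  This total is a sum over the points of a Poisson process,
    so its Laplace transform is controlled by its first two moments; the second
    moment is the sum over pairs of cells of heat kernels, which decay like
    [dist ^ (- d / 2)].  The gaps [g] are chosen so that this sum is of order
    [2 ^ k], whence a probability [exp (- c lam 2 ^ k)] that beats the number of
    skeletons for [lam] large.  The price of the gaps is the relation between
    [2 ^ k] and the radius: [sqrt t / log ^ 2], [t / log ^ 3] and [t] in
    dimension 1, 2 and at least 3. *)

(** * Skeletons of space-time paths *)

(** Badness of distant cells cannot be treated as independent: cells share nodes, and the
    correlations decay only polynomially. A Chernoff bound on the total number of visits needs only
    their average over a skeleton. The Poisson process is given through box counts of labelled
    nodes, with no control on the labelling. Initial positions are therefore rounded to a grid of
    mesh [ell / r], and a node counts as visiting a cell only if its path carries its whole grid box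
    into the cell. This undercounts, which is harmless since badness bounds the true counts from
    above. Given the boxes of all nodes, counted visits depend on the Brownian paths alone and are
    independent between nodes and coordinates, so expectations become finite sums. The series of 2^j
    g_j^(-d/2) must converge: the gaps g_j exceed 4^j for d = 1 and 2^j for d = 2 by powers of j,
    and may stay below 2^j for d at least 3. *)

Section Skeleton.
Variables (d : nat) (g : nat -> nat).
Implicit Types c y z : cell d.

Definition cdist c c' : nat :=
  maxn (\max_(j < d) `|c.1 j - c'.1 j|%N) `|c.2%:Z - c'.2%:Z|%N.

Lemma cdist_leP c c' (r : nat) :
  reflect ((forall j, (`|c.1 j - c'.1 j| <= r)%N) /\
           (`|c.2%:Z - c'.2%:Z| <= r)%N)
          (cdist c c' <= r)%N.
Proof.
rewrite /cdist geq_max; apply: (iffP andP) => -[H ?]; split=> //.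
  by move=> j; move/bigmax_leqP : H; apply.
by apply/bigmax_leqP.
Qed.

Lemma cdistC c c' : cdist c c' = cdist c' c.
Proof.
by rewrite /cdist distnC; congr maxn; apply: eq_bigr => j _; rewrite distnC.
Qed.

Lemma cdistxx c : cdist c c = 0%N.
Proof.
by apply/eqP; rewrite -leqn0; apply/cdist_leP; split=> [j|]; rewrite subrr.
Qed.

Lemma cdist_triangle c1 c2 c3 : (cdist c1 c3 <= cdist c1 c2 + cdist c2 c3)%N.
Proof.
have /cdist_leP[H1 K1] := leqnn (cdist c1 c2).
have /cdist_leP[H2 K2] := leqnn (cdist c2 c3).
apply/cdist_leP; split=> [j|]; last by lia.
by move: (H1 j) (H2 j); lia.
Qed.

Lemma adjacent_cdist c c' : adjacent c c' -> (cdist c c' <= 1)%N.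
Proof. by case=> _ [H K]; apply/cdist_leP; split=> [j|]; [move: (H j)|]; lia. Qed.

(** The set [B] varies in the recursion: the tail of a path after its last exit from a ball is a
    path in the smaller set of cells outside that ball. *)
Inductive conn (B : cell d -> Prop) y : cell d -> Prop :=
  | conn_refl : B y -> conn B y y
  | conn_step z z' : conn B y z -> adjacent z z' -> B z' -> conn B y z'.

Lemma conn_src B y z : conn B y z -> B y.
Proof. by elim. Qed.

(** The distance to [y] grows by at most 1 per step, so the cell after the last visit to the ball is
    at distance exactly [r.+1]. The induction restarts the tail whenever the previous cell is still
    inside the ball. *)
Lemma conn_last_exit (B : cell d -> Prop) y z (r : nat) :
  conn B y z -> (r < cdist y z)%N ->
  exists2 y', cdist y y' = r.+1 &
    conn (fun c => B c /\ (r < cdist y c)%N) y' z.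
Proof.
elim=> [_|{}z z' yz IH zz' Bz'] rz; first by rewrite cdistxx in rz.
have [zr|/IH[y' yy' y'z]] := leqP (cdist y z) r; last first.
  by exists y' => //; apply: conn_step y'z zz' _.
exists z'; last by apply: conn_refl.
apply/eqP; rewrite eqn_leq rz andbT.
apply: leq_trans (cdist_triangle _ z _) _.
by rewrite -addn1 leq_add// adjacent_cdist.
Qed.

(** The second half of a skeleton starts at distance [scale k' + g k' + 1], just outside a ball, and
    needs a further radius [scale k']. *)
Fixpoint scale k : nat :=
  if k is k'.+1 then (2 * scale k' + g k' + 1)%N else 0%N.

(** A list covering the ball, with repetitions: the truncated subtraction may list time 0 several
    times, which keeps the size formula exact. *)
Definition cball r y : seq (cell d) :=
  [seq ((fun j => y.1 j + (f j : nat)%:Z - r%:Z) : 'I_d -> int,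
        (y.2 + m - r)%N) |
    f : {ffun 'I_d -> 'I_(2 * r + 1)} <- enum {: {ffun 'I_d -> 'I_(2 * r + 1)}},
    m <- iota 0 (2 * r + 1)].

Lemma size_cball r y : size (cball r y) = ((2 * r + 1) ^ d.+1)%N.
Proof.
by rewrite size_allpairs size_iota -cardE card_ffun !card_ord -expnSr.
Qed.

Lemma mem_cball r y c : (cdist y c <= r)%N -> c \in cball r y.
Proof.
move=> /cdist_leP[H K]; apply/allpairsP.
have lt j : (`|(c.1 j - y.1 j + r%:Z)%R|%N < 2 * r + 1)%N by move: (H j); lia.
exists ([ffun j => Ordinal (lt j)], (c.2 + r - y.2)%N); split => /=.
- by rewrite mem_enum.
- by rewrite mem_iota; lia.
- case: c H K lt => ci ct /= H K lt; congr pair; last by lia.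
  by apply/funext => j; rewrite ffunE /=; move: (H j); lia.
Qed.

(** Candidates for skeletons rooted at [y]. Only their number matters, so the root of the second
    half ranges over a whole ball and separation is left to [spread]. *)
Fixpoint emb k y : seq (seq (cell d)) :=
  if k is k'.+1 then
    flatten [seq [seq s1 ++ s2 | s1 <- emb k' y, s2 <- emb k' y'] |
      y' <- cball (scale k' + g k' + 1) y]
  else [:: [:: y]].

Inductive spread : nat -> seq (cell d) -> Prop :=
  | spread0 y : spread 0 [:: y]
  | spreadS k s1 s2 : spread k s1 -> spread k s2 ->
      (forall c c', c \in s1 -> c' \in s2 -> (g k < cdist c c')%N) ->
      spread k.+1 (s1 ++ s2).

Lemma spread_size k s : spread k s -> size s = (2 ^ k)%N.
Proof.
by elim=> // {}k s1 s2 _ IH1 _ IH2 _; rewrite size_cat IH1 IH2 expnS mul2n addnn.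
Qed.

(* The first half of the skeleton stays within [scale k] of [y]; the second
   half starts at the last exit from a ball of larger radius, so the two halves
   are separated by [g k] and no cell of the path is spent twice. *)
Lemma conn_emb (B : cell d -> Prop) k y z :
  conn B y z -> (scale k <= cdist y z)%N ->
  exists s, [/\ s \in emb k y, spread k s,
    forall c, c \in s -> B c & forall c, c \in s -> (cdist y c <= scale k)%N].
Proof.
elim: k B y z => [|k IH] B y z yz Lz.
  exists [:: y]; split; [by rewrite inE | exact: spread0 | |].
    by move=> c; rewrite inE => /eqP ->; apply: conn_src yz.
  by move=> c; rewrite inE => /eqP ->; rewrite cdistxx.
have [|s1 [s1e s1s s1B s1d]] := IH _ _ _ yz.
  by apply: leq_trans Lz => /=; lia.
have [|y' yy' y'z] := @conn_last_exit _ _ _ (scale k + g k) yz.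
  by apply: leq_trans Lz => /=; lia.
have [|s2 [s2e s2s s2B s2d]] := IH _ _ _ y'z.
  by move: (cdist_triangle y y' z) Lz; rewrite yy' /=; lia.
exists (s1 ++ s2); split.
- rewrite /=; apply/flatten_mapP; exists y'.
    by apply: mem_cball; rewrite yy'; lia.
  by apply/allpairsP; exists (s1, s2).
- apply: spreadS => // c c' cs1 c's2.
  have [_] := s2B _ c's2; have := s1d _ cs1.
  by move: (cdist_triangle y c c'); lia.
- by move=> c; rewrite mem_cat => /orP[/s1B //|/s2B[]].
- move=> c; rewrite mem_cat => /orP[/s1d|/s2d] /=; first by lia.
  by move: (cdist_triangle y y' c); rewrite yy'; lia.
Qed.

(** The exponent solves e(k+1) = 2 e(k) + k + 1 with e(0) = 0: two half skeletons and the choice of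
    the second root. *)
Lemma size_emb (A : nat) k y :
  (forall j, (2 * (scale j + g j + 1) + 1) ^ d.+1 <= A ^ j.+1)%N ->
  (size (emb k y) <= A ^ (2 ^ k.+1 - k - 2))%N.
Proof.
move=> HA; elim: k y => [|k IH] y //=.
rewrite size_flatten /shape -map_comp sumnE big_map.
apply: (@leq_trans (\sum_(y' <- cball (scale k + g k + 1) y)
   (A ^ (2 ^ k.+1 - k - 2) * A ^ (2 ^ k.+1 - k - 2)))%N).
  by apply: leq_sum => y' _ /=; rewrite size_allpairs leq_mul.
rewrite big_const_seq count_predT iter_addn_0 size_cball.
apply: leq_trans (_ : _ <= A ^ (2 ^ k.+1 - k - 2) * A ^ (2 ^ k.+1 - k - 2)
  * A ^ k.+1)%N _; first by rewrite leq_mul2l HA orbT.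
have E : (k + 2 <= 2 ^ k.+1)%N.
  by elim: k {IH} => // k IH; move: IH; rewrite [(2 ^ k.+2)%N]expnS; lia.
by rewrite -!expnD [(2 ^ k.+2)%N]expnS; apply: eq_leq; congr (_ ^ _)%N; lia.
Qed.

Definition energy (R : realType) (p : cell d -> cell d -> R) s : R :=
  \sum_(c <- s) \sum_(c' <- s) p c c'.

(** Joining two halves of level k creates twice (2^k)^2 cross pairs, each at most [rho k]; divided
    by the 2^(k+1) cells this is one more term of the sum. The 1 comes from the diagonal. *)
Lemma spread_energy (R : realType) (p : cell d -> cell d -> R) (rho : nat -> R) k s :
  (forall c, p c c <= 1) ->
  (forall c c' j, (g j < cdist c c')%N -> p c c' <= rho j) ->
  spread k s ->
  energy p s <= (2 ^ k)%:R * (1 + \sum_(j < k) (2 ^ j)%:R * rho j).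
Proof.
move=> p1 prho; elim=> {k s} [y|k s1 s2 S1 IH1 S2 IH2 sep].
  by rewrite /energy !big_seq1 big_ord0 expn0 mul1r addr0.
have cross s s' : size s = (2 ^ k)%N -> size s' = (2 ^ k)%N ->
    (forall c c', c \in s -> c' \in s' -> (g k < cdist c c')%N) ->
    \sum_(c <- s) \sum_(c' <- s') p c c' <= (2 ^ k)%:R * ((2 ^ k)%:R * rho k).
  move=> Es Es' H.
  apply: (@le_trans _ _ (\sum_(c <- s) \sum_(c' <- s') rho k)).
    rewrite big_seq [leRHS]big_seq; apply: ler_sum => c cs.
    rewrite big_seq [leRHS]big_seq; apply: ler_sum => c' cs'.
    exact/prho/H.
  rewrite !big_const_seq !count_predT Es Es' !iter_addr !addr0.
  by rewrite !mulr_natl.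
have E : energy p (s1 ++ s2) = energy p s1 + energy p s2 +
   (\sum_(c <- s1) \sum_(c' <- s2) p c c' + \sum_(c <- s2) \sum_(c' <- s1) p c c').
  rewrite /energy big_cat /=.
  under eq_bigr do rewrite big_cat /=.
  under [X in _ + X = _]eq_bigr do rewrite big_cat /=.
  by rewrite !big_split /=; ring.
have C1 := cross _ _ (spread_size S1) (spread_size S2) sep.
have C2 : \sum_(c <- s2) \sum_(c' <- s1) p c c' <= (2 ^ k)%:R * ((2 ^ k)%:R * rho k).
  apply: cross; [exact: spread_size|exact: spread_size|].
  by move=> c c' H H'; rewrite cdistC; apply: sep.
rewrite E big_ord_recr /= expnS natrM.
lra.
Qed.

End Skeleton.

(** * Chernoff bound for independent hitting counts *)

Section RealProbability.
Context {R : realType} {dT : measure_display} {T : measurableType dT}.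
Variable P : probability T R.

Definition pr (A : set T) : R := fine (P A).

Lemma prE A : measurable A -> P A = (pr A)%:E.
Proof. by move=> mA; rewrite /pr fineK// fin_num_measure. Qed.

Lemma pr_ge0 A : 0 <= pr A.
Proof. by rewrite fine_ge0. Qed.

Lemma pr_setT : pr setT = 1.
Proof. by rewrite /pr probability_setT. Qed.

Lemma pr_set0 : pr set0 = 0.
Proof. by rewrite /pr measure0. Qed.

Lemma pr_le A B : measurable A -> measurable B -> A `<=` B -> pr A <= pr B.
Proof.
move=> mA mB AB; rewrite -lee_fin -!prE//.
by apply: le_measure => //; rewrite inE.
Qed.

Lemma pr_le1 A : measurable A -> pr A <= 1.
Proof. by move=> mA; rewrite -pr_setT; apply: pr_le. Qed.

Lemma pr_setU_le A B : measurable A -> measurable B -> pr (A `|` B) <= pr A + pr B.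
Proof.
move=> mA mB; have mAB := measurableU _ _ mA mB.
by rewrite -lee_fin EFinD -!prE// measureU2.
Qed.

Lemma pr_setC A : measurable A -> pr (~` A) = 1 - pr A.
Proof.
move=> mA; have mC := measurableC mA; apply: EFin_inj.
by rewrite EFinB -!prE// probability_setC.
Qed.

Lemma pr_setUD A B : measurable A -> measurable B -> A `&` B = set0 ->
  pr (A `|` B) = pr A + pr B.
Proof.
move=> mA mB AB; have mAB := measurableU _ _ mA mB.
by apply: EFin_inj; rewrite EFinD -!prE// measureU.
Qed.

Lemma pr_exists_seq_le (I : eqType) (s : seq I) (F : I -> set T) (A : set T) :
  (forall i, measurable (F i)) -> measurable A ->
  (forall w, A w -> exists2 i, i \in s & F i w) ->
  pr A <= \sum_(i <- s) pr (F i).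
Proof.
move=> mF; elim: s A => [|i s IH] A mA H.
  rewrite big_nil (_ : A = set0) ?pr_set0// -subset0 => w /H[i].
  by rewrite in_nil.
rewrite big_cons; apply: (@le_trans _ _ (pr (F i `|` (A `\` F i)))).
  apply: pr_le => //; first by apply: measurableU => //; apply: measurableD.
  by move=> w Aw; have [?|?] := pselect (F i w); [left|right].
apply: le_trans (pr_setU_le _ _) _ => //; first exact: measurableD.
rewrite lerD2l; apply: IH; first exact: measurableD.
move=> w [/H[j]]; rewrite inE => /orP[/eqP->//|js Fj _].
by exists j.
Qed.

Lemma pr_exists_fin_le (I : finType) (Q : pred I) (F : I -> set T) (A : set T) :
  (forall i, measurable (F i)) -> measurable A ->
  (forall w, A w -> exists2 i, Q i & F i w) ->
  pr A <= \sum_(i | Q i) pr (F i).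
Proof.
move=> mF mA H; rewrite big_mkcond -big_filter.
rewrite -[X in _ <= X]big_mkcond -big_filter.
apply: pr_exists_seq_le => // w /H[i Qi Fi]; exists i => //.
by rewrite !mem_filter Qi/= mem_index_enum.
Qed.

Lemma pr_partition (I : finType) (Q : pred I) (F : I -> set T) :
  (forall i, measurable (F i)) ->
  (forall i j w, F i w -> F j w -> i = j) ->
  \sum_(i | Q i) pr (F i) = pr [set w | exists2 i, Q i & F i w].
Proof.
move=> mF dF; suff H (s : seq I) : uniq s ->
    measurable [set w | exists2 i, i \in s & F i w] /\
    \sum_(i <- s) pr (F i) = pr [set w | exists2 i, i \in s & F i w].
  rewrite -big_filter; have [|_ ->] := H [seq i <- index_enum I | Q i].
    by rewrite filter_uniq// index_enum_uniq.
  congr pr; apply/seteqP; split=> w [i iQ Fi]; exists i => //.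
    by move: iQ; rewrite mem_filter => /andP[].
  by rewrite mem_filter iQ mem_index_enum.
elim: s => [_|i s IH /= /andP[nis us]].
  have -> : [set w | exists2 i, i \in [::] & F i w] = set0.
    by rewrite -subset0 => w [].
  by rewrite big_nil pr_set0.
have [mS ES] := IH us.
have E : [set w | exists2 j, j \in i :: s & F j w] =
    F i `|` [set w | exists2 j, j \in s & F j w].
  apply/seteqP; split=> w.
    by move=> [j]; rewrite inE => /orP[/eqP ->|js] Fj; [left|right; exists j].
  move=> [Fi|[j js Fj]]; first by exists i => //; rewrite mem_head.
  by exists j => //; rewrite inE js orbT.
split; first by rewrite E; apply: measurableU.
rewrite E pr_setUD// ?big_cons ?ES// -subset0 => w [Fi [j js Fj]].
by rewrite (dF _ _ _ Fi Fj) js in nis.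
Qed.

Lemma pr_bigcup_nondecr_le (F : nat -> set T) (x : R) :
  (forall i, measurable (F i)) -> (forall i w, F i w -> F i.+1 w) ->
  (forall i, pr (F i) <= x) -> pr (\bigcup_i F i) <= x.
Proof.
move=> mF ndF Fx; have mU : measurable (\bigcup_i F i) by apply: bigcupT_measurable.
rewrite -lee_fin -prE//.
have cvg : P \o F @ \oo --> P (\bigcup_i F i).
  apply: nondecreasing_cvg_mu => //.
  by apply/nondecreasing_seqP => n; rewrite subsetEset; exact: ndF.
rewrite -(cvg_lim _ cvg)//; apply: lime_le; first by apply/cvg_ex; exists (P (\bigcup_i F i)).
by apply: nearW => i /=; rewrite prE// lee_fin.
Qed.

Lemma measurable_forall_fin (I : finType) (F : I -> set T) :
  (forall i, measurable (F i)) -> measurable [set w | forall i, F i w].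
Proof.
move=> mF; rewrite (_ : [set w | _] = \big[setI/setT]_i F i).
  exact: bigsetI_measurable.
apply/seteqP; split=> w; rewrite -bigcap_seq; first by move=> H i _.
by move=> H i; apply: (H i); rewrite /= mem_index_enum.
Qed.

End RealProbability.

(** Since (1 + x)(1 - x + x^2) = 1 + x^3, this follows from exp x >= 1 + x. *)
Lemma expRN_le_quad {R : realType} (x : R) : 0 <= x -> expR (- x) <= 1 - x + x ^+ 2.
Proof.
move=> x0; rewrite expRN; have x1 := expR_ge1Dx x.
have p : 0 < 1 + x by lra.
apply: (@le_trans _ _ (1 + x)^-1).
  by rewrite lef_pV2 ?posrE ?expR_gt0.
rewrite -(@ler_pM2l _ (1 + x))// mulfV ?gt_eqF//.
by have := exprn_ge0 3 x0; nra.
Qed.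

Section Laplace.
Context {R : realType} {dT : measure_display} {T : measurableType dT}.
Variable P : probability T R.
Variables d n : nat.
Implicit Types Ev : 'I_d -> 'I_n -> set T.

Definition atom (E : 'I_n -> set T) (B : {set 'I_n}) : set T :=
  [set w | forall c, E c w <-> c \in B].

Lemma measurable_atom (E : 'I_n -> set T) B :
  (forall c, measurable (E c)) -> measurable (atom E B).
Proof.
move=> mE; rewrite (_ : atom E B = [set w | forall c, (if c \in B then E c else ~` E c) w]).
  apply: (@measurable_forall_fin _ _ _ (fun c => if c \in B then E c else ~` E c)) => c.
  by case: ifP => _ //; apply: measurableC.
apply/seteqP; split=> w H c; have := H c; case: ifPn => // cB Hc; first exact/Hc.
by move=> /Hc.
Qed.

Lemma atom_inj (E : 'I_n -> set T) B B' w : atom E B w -> atom E B' w -> B = B'.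
Proof.
by move=> H H'; apply/setP => c; apply/idP/idP => cB; [apply/H'/H|apply/H/H'].
Qed.

Lemma atom_ex (E : 'I_n -> set T) w : atom E [set c | `[< E c w >]]%SET w.
Proof. by move=> c; rewrite inE; split => /asboolP. Qed.

Lemma sum_pr_atom (E : 'I_n -> set T) (Q : pred {set 'I_n}) :
  (forall c, measurable (E c)) ->
  \sum_(B | Q B) pr P (atom E B) = pr P [set w | Q [set c | `[< E c w >]]%SET].
Proof.
move=> mE; rewrite pr_partition; last exact: atom_inj.
  congr (pr P); apply/seteqP; split=> w /=.
    by move=> [B QB /atom_inj -/(_ _ (@atom_ex E w)) <-].
  by move=> Qw; eexists; [exact: Qw|exact: atom_ex].
by move=> B; apply: measurable_atom.
Qed.

Definition hits (b : {ffun 'I_d -> {set 'I_n}}) : nat :=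
  \sum_c [forall j, c \in b j].

(** Laplace transform of the number of indices [c] hit in all coordinates at once, under the product
    of the laws of the coordinates. *)
Definition laplace Ev (theta : R) : R :=
  \sum_(b : {ffun 'I_d -> {set 'I_n}})
    (\prod_j pr P (atom (Ev j) (b j))) * expR (- (theta * (hits b)%:R)).

Lemma laplace_ge0 Ev theta : 0 <= laplace Ev theta.
Proof.
apply: sumr_ge0 => b _; rewrite mulr_ge0 ?expR_ge0// prodr_ge0// => j _.
exact: pr_ge0.
Qed.

Let prod_and (I : finType) (q : pred I) : ([forall j, q j])%:R = \prod_j (q j)%:R :> R.
Proof.
have [/forallP H|] := boolP [forall j, q j].
  by rewrite big1// => j _; rewrite H.
by rewrite negb_forall => /existsP[j /negbTE qj]; rewrite (bigD1 j)//= qj mul0r.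
Qed.

(** Expectation of a product over coordinates under the product law; the moments of [hits] reduce to
    sums of such expectations. *)
Lemma sum_atoms Ev (q : 'I_d -> pred {set 'I_n}) :
  (forall j c, measurable (Ev j c)) ->
  \sum_(b : {ffun 'I_d -> {set 'I_n}})
    (\prod_j pr P (atom (Ev j) (b j))) * [forall j, q j (b j)]%:R =
  \prod_j pr P [set w | q j [set c | `[< Ev j c w >]]%SET].
Proof.
move=> mE.
transitivity (\prod_j \sum_(B : {set 'I_n}) pr P (atom (Ev j) B) * (q j B)%:R).
  rewrite bigA_distr_bigA; apply: eq_bigr => b _.
  by rewrite prod_and -big_split.
apply: eq_bigr => j _; rewrite -sum_pr_atom// [RHS]big_mkcond/=.
by apply: eq_bigr => B _; case: (q j B); rewrite ?mulr1 ?mulr0.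
Qed.

Lemma laplace_le Ev (theta : R) : 0 <= theta -> (forall j c, measurable (Ev j c)) ->
  laplace Ev theta <= 1 - theta * (\sum_c \prod_j pr P (Ev j c))
    + theta ^+ 2 * (\sum_c \sum_c' \prod_j pr P (Ev j c `&` Ev j c')).
Proof.
move=> t0 mE.
(* Total mass, first and second moment of [hits], matching the three terms of the quadratic bound on
   the exponential. *)
have E0 : \sum_(b : {ffun 'I_d -> {set 'I_n}}) (\prod_j pr P (atom (Ev j) (b j))) = 1.
  have := @sum_atoms Ev (fun _ _ => true) mE.
  rewrite [X in _ = X]big1 => [H|j _].
    rewrite -[RHS]H; apply: eq_bigr => b _; suff -> : [forall j : 'I_d, true] by rewrite mulr1.
    exact/forallP.
  by rewrite (_ : [set w | _] = setT) ?pr_setT//; apply/seteqP.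
have E1 : \sum_(b : {ffun 'I_d -> {set 'I_n}})
    (\prod_j pr P (atom (Ev j) (b j))) * (hits b)%:R = \sum_c \prod_j pr P (Ev j c).
  under eq_bigr do rewrite /hits natr_sum mulr_sumr.
  rewrite exchange_big/=; apply: eq_bigr => c _.
  rewrite (@sum_atoms Ev (fun _ B => c \in B))//; apply: eq_bigr => j _.
  by congr (pr P); apply/seteqP; split=> w /=; rewrite inE => /asboolP.
have E2 : \sum_(b : {ffun 'I_d -> {set 'I_n}})
    (\prod_j pr P (atom (Ev j) (b j))) * (hits b)%:R ^+ 2 =
    \sum_c \sum_c' \prod_j pr P (Ev j c `&` Ev j c').
  transitivity (\sum_(b : {ffun 'I_d -> {set 'I_n}}) \sum_c \sum_c'
     (\prod_j pr P (atom (Ev j) (b j))) * [forall j, (c \in b j) && (c' \in b j)]%:R).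
    apply: eq_bigr => b _; rewrite /hits natr_sum expr2 big_distrlr/= mulr_sumr.
    apply: eq_bigr => c _; rewrite mulr_sumr; apply: eq_bigr => c' _.
    congr (_ * _); rewrite -natrM mulnb; congr (_%:R); congr nat_of_bool.
    apply/andP/forallP => [[/forallP H /forallP H'] j|H].
      by rewrite H H'.
    by split; apply/forallP => j; have /andP[] := H j.
  rewrite exchange_big/=; apply: eq_bigr => c _.
  rewrite exchange_big/=; apply: eq_bigr => c' _.
  rewrite (@sum_atoms Ev (fun _ B => (c \in B) && (c' \in B)))//.
  apply: eq_bigr => j _; congr (pr P); apply/seteqP; split=> w /=; rewrite !inE.
    by move=> /andP[/asboolP ? /asboolP].
  by move=> [? ?]; apply/andP; split; apply/asboolP.
rewrite -E1 -E2 -[X in X - _ + _]E0 !mulr_sumr -sumrB -big_split/=.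
apply: ler_sum => b _; set A := \prod_j _; set f := (hits b)%:R.
have A0 : 0 <= A by apply: prodr_ge0 => j _; exact: pr_ge0.
rewrite (_ : A - _ + _ = A * (1 - theta * f + (theta * f) ^+ 2)); last by ring.
by apply: ler_wpM2l => //; apply: expRN_le_quad; rewrite mulr_ge0.
Qed.

End Laplace.

Section Chernoff.
Context {R : realType} {dT : measure_display} {T : measurableType dT}.
Variable P : probability T R.

(** Exponential Markov inequality on finitely many joint atoms: [A] is covered by atoms with at most
    [m] hits, for which exp (theta (m - hits)) is at least 1. Independence enters only as a product
    formula for atoms; [E0] will be the configuration of initial boxes. *)
Lemma chernoff_lower (K d n : nat) (Ev : 'I_K -> 'I_d -> 'I_n -> set T)
    (E0 A : set T) (theta m : R) :
  0 <= theta ->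
  (forall k j c, measurable (Ev k j c)) -> measurable E0 -> measurable A ->
  (forall b : 'I_K -> 'I_d -> {set 'I_n},
     pr P (E0 `&` [set w | forall k j, atom (Ev k j) (b k j) w]) =
     pr P E0 * \prod_k \prod_j pr P (atom (Ev k j) (b k j))) ->
  (forall w, A w -> E0 w /\
     \sum_k \sum_c [forall j, `[< Ev k j c w >]]%:R <= m) ->
  pr P A <= pr P E0 * expR (theta * m) * \prod_k laplace P (Ev k) theta.
Proof.
move=> t0 mE mE0 mA ind HA.
pose F (b : {ffun 'I_K -> {ffun 'I_d -> {set 'I_n}}}) :=
  E0 `&` [set w | forall k j, atom (Ev k j) (b k j) w].
have mF b : measurable (F b).
  apply: measurableI => //.
  apply: (@measurable_forall_fin _ _ _ (fun k => [set w | forall j, atom (Ev k j) (b k j) w])).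
  move=> k; apply: (@measurable_forall_fin _ _ _ (fun j => atom (Ev k j) (b k j))) => j.
  exact: measurable_atom.
pose Q (b : {ffun 'I_K -> {ffun 'I_d -> {set 'I_n}}}) : bool :=
  (\sum_k (hits (b k))%:R <= m :> R).
have H1 : pr P A <= \sum_(b | Q b) pr P (F b).
  apply: pr_exists_fin_le => // w /HA[Ew cw].
  exists [ffun k => [ffun j => [set c | `[< Ev k j c w >]]%SET]].
    rewrite /Q; apply: le_trans cw; apply: ler_sum => k _.
    rewrite /hits natr_sum; apply: ler_sum => c _.
    rewrite ler_nat; case: forallP => // H; rewrite lt0b; apply/forallP => j.
    by have := H j; rewrite !ffunE inE.
  by split=> // k j; rewrite !ffunE; exact: atom_ex.
apply: le_trans H1 _.
apply: (@le_trans _ _ (\sum_(b : {ffun 'I_K -> {ffun 'I_d -> {set 'I_n}}})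
  pr P E0 * expR (theta * m) * \prod_k ((\prod_j pr P (atom (Ev k j) (b k j)))
     * expR (- (theta * (hits (b k))%:R))))).
  rewrite big_mkcond/=; apply: ler_sum => b _.
  have p0 : 0 <= \prod_k \prod_j pr P (atom (Ev k j) (b k j)).
    by do 2 apply: prodr_ge0 => ? _; exact: pr_ge0.
  rewrite big_split/= -expR_sum -mulrA [expR _ * _]mulrCA -expRD.
  case: ifPn => Qb; last by rewrite !mulr_ge0 ?pr_ge0 ?expR_ge0.
  rewrite ind -[leLHS]mulr1 -mulrA ler_wpM2l ?pr_ge0// ler_wpM2l//.
  rewrite -[leLHS]expR0 ler_expR sumrN -mulr_sumr -mulrBr mulr_ge0// subr_ge0.
  exact: Qb.
by rewrite -mulr_sumr /laplace bigA_distr_bigA.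
Qed.

End Chernoff.

(** * Grid intervals and the Gaussian law *)

Section Counting.
Context {R : realType} {dT : measure_display} {T : measurableType dT}.
Variables (P : probability T R) (n : nat) (E : 'I_n -> set T).
Hypothesis mE : forall c, measurable (E c).

Lemma sum_pr_card : \sum_c pr P (E c) = \sum_(B : {set 'I_n}) #|B|%:R * pr P (atom E B).
Proof.
transitivity (\sum_c \sum_(B : {set 'I_n}) (c \in B)%:R * pr P (atom E B)).
  apply: eq_bigr => c _.
  transitivity (\sum_(B : {set 'I_n} | c \in B) pr P (atom E B)).
    rewrite sum_pr_atom//; congr (pr P); apply/seteqP; split=> w /=; rewrite inE.
      by move=> ?; apply/asboolP.
    by move/asboolP.
  by rewrite big_mkcond/=; apply: eq_bigr => B _; case: ifP; rewrite ?mul1r ?mul0r.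
rewrite exchange_big/=; apply: eq_bigr => B _.
rewrite -mulr_suml -natr_sum; congr (_%:R * _).
by rewrite -sum1_card [RHS]big_mkcond/=; apply: eq_bigr => c _; case: ifP.
Qed.

Lemma sum_pr_le (r : nat) :
  (forall w (B : {set 'I_n}), (forall c, c \in B -> E c w) -> (#|B| <= r)%N) ->
  \sum_c pr P (E c) <= r%:R.
Proof.
move=> H; rewrite sum_pr_card.
apply: (@le_trans _ _ (\sum_(B : {set 'I_n}) r%:R * pr P (atom E B))).
  apply: ler_sum => B _; have [->|/set0P[w wB]] := eqVneq (atom E B) set0.
    by rewrite pr_set0 !mulr0.
  apply: ler_wpM2r; first exact: pr_ge0.
  by rewrite ler_nat; apply: (H w) => c /wB.
rewrite -mulr_sumr sum_pr_atom// (_ : [set w | _] = setT) ?pr_setT ?mulr1//.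
by apply/seteqP.
Qed.

Lemma sum_pr_ge (r : nat) (V : set T) : measurable V ->
  (forall w, V w -> exists2 B : {set 'I_n}, (forall c, c \in B -> E c w) &
     (r <= #|B|)%N) ->
  r%:R * pr P V <= \sum_c pr P (E c).
Proof.
move=> mV H; rewrite sum_pr_card.
pose Q (B : {set 'I_n}) := (r <= #|B|)%N.
apply: (@le_trans _ _ (r%:R * \sum_(B | Q B) pr P (atom E B))).
  apply: ler_wpM2l => //; apply: pr_exists_fin_le => //.
    by move=> B; apply: measurable_atom.
  move=> w /H[B EB rB]; exists [set c | `[< E c w >]]%SET; last exact: atom_ex.
  apply: leq_trans rB _; apply: subset_leq_card; apply/fintype.subsetP => c /EB Ec.
  by rewrite inE; apply/asboolP.
rewrite mulr_sumr big_mkcond/=; apply: ler_sum => B _.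
case: ifPn => [rB|_]; last by rewrite mulr_ge0// pr_ge0.
by apply: ler_wpM2r; [exact: pr_ge0|rewrite ler_nat].
Qed.

End Counting.

Lemma card_diam_le (N r : nat) (B : {set 'I_N}) :
  (forall q q', q \in B -> q' \in B -> (q' < q + r)%N) -> (#|B| <= r)%N.
Proof.
move=> H; have [->|/set0Pn[q1 q1B]] := eqVneq B finset.set0; first by rewrite cards0.
case: (@arg_minnP _ q1 (mem B) (@nat_of_ord N) q1B) => q0 q0B q0min.
have r0 : (0 < r)%N by move: (H q0 q0 q0B q0B); lia.
case: r r0 H => // r _ H.
rewrite -[r.+1]card_ord -(@card_in_imset _ _ (fun q : 'I_N => inord (q - q0) : 'I_r.+1)).
  exact: max_card.
move=> q q' qB q'B /(congr1 val) /=; rewrite !inordK.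
- by move=> E; apply: val_inj => /=; move: (q0min _ qB) (q0min _ q'B) E; lia.
- by move: (H _ _ q0B q'B) (q0min _ q'B); lia.
- by move: (H _ _ q0B qB) (q0min _ qB); lia.
Qed.

Section Slots.
Context {R : realType}.
Variables (ell : R) (r M : nat).
Hypotheses (ell0 : 0 < ell) (r0 : (0 < r)%N).
Local Notation delta := (ell / r%:R).

Definition gridpt (q : 'I_(2 * M)) : R := (q%:R - M%:R) * delta.

(** Displacements that carry the whole grid interval [q] into the interval of index [i]. Whether
    this happens does not depend on where in the grid interval the node started. *)
Definition slot (i : int) (q : 'I_(2 * M)) : set R :=
  [set y | i%:~R * ell <= gridpt q + y /\ gridpt q + delta + y <= (i + 1)%:~R * ell].

Lemma delta_gt0 : 0 < delta.
Proof. by rewrite divr_gt0// ltr0n. Qed.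

Lemma slotE i q : slot i q =
  `[i%:~R * ell - gridpt q, (i + 1)%:~R * ell - (gridpt q + delta)]%classic.
Proof.
apply/seteqP; split=> y /=; rewrite in_itv/= lerBlDl lerBrDl.
  by move=> [-> ->].
by move=> /andP[].
Qed.

Lemma measurable_slot i q : measurable (slot i q).
Proof. by rewrite slotE. Qed.

(** For each fixed displacement at most [r] grid intervals of length [ell / r] fit into an interval
    of length [ell]. *)
Lemma slot_sum_le (mu : probability (measurableTypeR R) R) i : \sum_q pr mu (slot i q) <= r%:R.
Proof.
apply: sum_pr_le => [q|y B HB]; first exact: measurable_slot.
apply: card_diam_le => q q' /HB[H1 H2] /HB[H3 H4].
have d0 := delta_gt0.
have E : r%:R * delta = ell by rewrite mulrC mulfVK// pnatr_eq0 -lt0n.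
have : gridpt q' + delta <= gridpt q + r%:R * delta.
  by rewrite E; move: H1 H4; rewrite intrD; lra.
rewrite /gridpt -(ltr_nat R) natrD -(ltr_pM2r d0); lra.
Qed.

(** An interval of length [r] meshes contains at least [r.-1] whole mesh intervals; the bound on [y]
    keeps them inside the grid. *)
Lemma slot_card_ge i y : `|y| / delta + (`|i| * r + r + 2)%:R <= M%:R ->
  exists2 B : {set 'I_(2 * M)}, (forall q, q \in B -> slot i q y) & (r.-1 <= #|B|)%N.
Proof.
move=> HM; have d0 := delta_gt0.
(* Left end of the interval of index [i], shifted back by [y], in mesh units; the chosen slots start
   at its ceiling. *)
pose x : R := i%:~R * r%:R - y / delta.
have Ei : i%:~R * ell = i%:~R * r%:R * delta.
  by rewrite -mulrA [r%:R * _]mulrC mulfVK// pnatr_eq0 -lt0n.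
have Ey : y / delta * delta = y by rewrite mulfVK// gt_eqF.
have x1 : x <= (Num.ceil x)%:~R := ceil_ge x.
have x2 : (Num.ceil x)%:~R < x + 1.
  by have := ceilB1_lt x; rewrite intrB; lra.
have xM : `|x| <= M%:R - r%:R - 2.
  apply: le_trans (ler_normB _ _) _; rewrite normrM normf_div.
  rewrite (gtr0_norm d0) [`|r%:R|]ger0_norm//.
  move: HM; rewrite !natrD natrM natr_absz -intr_norm; lra.
have : - (M%:R - r%:R - 2) <= x <= M%:R - r%:R - 2 by rewrite -ler_norml.
move=> /andP[xl xu].
have cM : 0 <= Num.ceil x + M%:Z.
  by rewrite -(ler0z R) intrD -[M%:~R]/(M%:R); have := ler0n R r; lra.
pose z := `|(Num.ceil x + M%:Z)%R|%N.
have Ez : z%:R = (Num.ceil x)%:~R + M%:R :> R.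
  by rewrite /z natr_absz ger0_norm// rmorphD.
have tr (t : 'I_r.-1) : t%:R + 2 <= r%:R :> R.
  by rewrite -natrD ler_nat; case: t => t /=; lia.
have t0 (t : 'I_r.-1) : 0 <= t%:R :> R by rewrite ler0n.
have rng (t : 'I_r.-1) : (z + t < 2 * M)%N.
  by rewrite -(ltr_nat R) natrD natrM Ez; move: (tr t); lra.
exists [set Ordinal (rng t) | t in 'I_r.-1]%SET.
  have Ei1 : (i + 1)%:~R * ell = i%:~R * ell + ell by rewrite intrD mulrDl mul1r.
  move=> _ /imsetP[t _ ->]; rewrite /slot /gridpt /= natrD Ez Ei1 Ei.
  have Er : ell = r%:R * delta by rewrite mulrC mulfVK// pnatr_eq0 -lt0n.
  rewrite -Ey.
  have E1 : i%:~R * r%:R * delta = x * delta + y / delta * delta by rewrite /x; ring.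
  rewrite E1 [X in _ /\ _ <= _ + X]Er; split.
    by rewrite lerD2r ler_pM2r//; move: (t0 t); lra.
  move: (tr t) (t0 t) => H1 H2.
  have : ((Num.ceil x)%:~R + M%:R + t%:R - M%:R + 1) * delta <= (x + r%:R) * delta.
    by rewrite ler_pM2r//; lra.
  lra.
rewrite card_imset ?card_ord// => t t' /(congr1 val) /= E; apply: val_inj => /=; lia.
Qed.

End Slots.

Lemma pr_norm_le_near1 {R : realType} (mu : probability (measurableTypeR R) R) (eta : R) :
  0 < eta -> exists v : nat, 1 - eta <= pr mu [set y | `|y| <= v%:R].
Proof.
move=> eta0; apply: contrapT => /forallNP H.
have : pr mu (\bigcup_(v : nat) [set y | `|y| <= v%:R]) <= 1 - eta.
  apply: pr_bigcup_nondecr_le => [v|v y /= yv|v].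
  - rewrite (_ : [set y | _] = `[- v%:R, v%:R]%classic)//.
    by apply/seteqP; split=> y /=; rewrite in_itv/= ler_norml.
  - by apply: le_trans yv _; rewrite ler_nat.
  - by have := H v; move/negP; rewrite -ltNge => /ltW.
rewrite (_ : \bigcup_v _ = setT) ?pr_setT; first by lra.
apply/seteqP; split=> // y _; exists (Num.truncn `|y|).+1 => //=.
by apply: ltW; exact: truncnS_gt.
Qed.

(** By tightness [mu] almost sits on bounded displacements, for which a large enough grid offers
    [r.-1] slots. *)
Lemma slot_sum_ge {R : realType} (ell : R) (r : nat) (mu : probability (measurableTypeR R) R)
    (i : int) (eta : R) : 0 < ell -> (0 < r)%N -> 0 < eta ->
  exists M0, forall M, (M0 <= M)%N ->
    r.-1%:R * (1 - eta) <= \sum_q pr mu (@slot R ell r M i q).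
Proof.
move=> ell0 r0 eta0; have [v Hv] := pr_norm_le_near1 mu eta0.
have d0 := delta_gt0 ell0 r0.
pose M0 := ((Num.truncn (v%:R / (ell / r%:R))).+1 + (`|i| * r + r + 2))%N.
exists M0 => M MM.
apply: (@le_trans _ _ (r.-1%:R * pr mu [set y | `|y| <= v%:R])).
  exact: ler_wpM2l.
apply: sum_pr_ge.
- by move=> q; exact: measurable_slot.
- rewrite (_ : [set y | _] = `[- v%:R, v%:R]%classic)//.
  by apply/seteqP; split=> y /=; rewrite in_itv/= ler_norml.
- move=> y /= yv; apply: slot_card_ge => //.
  apply: (@le_trans _ _ M0%:R); last by rewrite ler_nat.
  rewrite [M0%:R]natrD lerD2r; apply: (@le_trans _ _ (v%:R / (ell / r%:R))).
    by rewrite ler_pM2r ?invr_gt0.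
  by apply: ltW; exact: truncnS_gt.
Qed.

Section GaussianLaw.
Context {R : realType}.
Local Notation MR := (measurableTypeR R).

(* [normal_prob 0 0] is not the point mass at [0], hence the case distinction. *)
Definition glaw (s : R) : probability MR R :=
  if s == 0 then [the probability MR R of \d_(0 : MR)]
  else [the probability MR R of normal_prob 0 (Num.sqrt s)].

Variable ell : R.
Hypothesis ell0 : 0 < ell.

Definition near_set (z : int) : set R := `](z - 1)%:~R * ell, (z + 1)%:~R * ell[%classic.

Lemma measurable_near_set z : measurable (near_set z).
Proof. exact: measurable_itv. Qed.

Lemma lebesgue_near_set z : lebesgue_measure (near_set z) = (2 * ell)%:E.
Proof.
rewrite /near_set lebesgue_measure_itv/= lte_fin ltr_pM2r// ltr_int ifT; last by lia.
by rewrite -EFinB; congr EFin; rewrite intrD intrB; ring.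
Qed.

Lemma glaw0_near z : z != 0 -> pr (glaw 0) (near_set z) = 0.
Proof.
move=> z0; rewrite /glaw eqxx /pr /= indicE.
case: (boolP (_ \in _)) => //; rewrite inE /near_set /= in_itv/=.
rewrite pmulr_llt0// pmulr_lgt0// (_ : 0 = 0%:~R)// !ltr_int; lia.
Qed.

Lemma normal_peak_le (s : R) : 0 < s -> normal_peak (Num.sqrt s) <= (Num.sqrt s)^-1.
Proof.
move=> s0; rewrite /normal_peak lef_pV2 ?posrE ?sqrtr_gt0//.
  rewrite ler_sqrt; last first.
    by rewrite mulrn_wge0// mulr_ge0 ?sqr_ge0 ?pi_ge0.
  by rewrite sqr_sqrtr ?ltW//; have := pi_ge2 R; nra.
by rewrite mulrn_wgt0// mulr_gt0 ?pi_gt0// sqr_sqrtr ?ltW.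
Qed.

Lemma glaw_near_le (s e : R) z : 0 < s -> 0 <= e ->
  (forall y, near_set z y -> expR (- y ^+ 2 / (s *+ 2)) <= e) ->
  pr (glaw s) (near_set z) <= 2 * ell * (Num.sqrt s)^-1 * e.
Proof.
move=> s0 e0 He; have ss0 : Num.sqrt s != 0 by rewrite gt_eqF// sqrtr_gt0.
rewrite /glaw gt_eqF// -lee_fin -prE; last exact: measurable_near_set.
rewrite /normal_prob /=.
have k0 : 0 <= (Num.sqrt s)^-1 * e by rewrite mulr_ge0// invr_ge0 sqrtr_ge0.
apply: (@le_trans _ _ (\int[lebesgue_measure]_(x in near_set z)
   (cst ((Num.sqrt s)^-1 * e)%:E x))%E).
  apply: ge0_le_integral => //; first exact: measurable_near_set.
  - by move=> x _; rewrite lee_fin normal_pdf_ge0.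
  - apply/measurable_EFinP; apply: measurable_funTS; exact: measurable_normal_pdf.
  - move=> x xz; rewrite /= lee_fin normal_pdfE//= /normal_fun subr0 sqr_sqrtr; last exact: ltW.
    apply: ler_pM; rewrite ?normal_peak_ge0 ?expR_ge0//; first exact: normal_peak_le.
    exact: He.
rewrite integral_cst; last exact: measurable_near_set.
rewrite [X in (_ * X)%E](_ : _ = (2 * ell)%:E); last exact: lebesgue_near_set.
by rewrite -EFinM lee_fin le_eqVlt; apply/orP; left; apply/eqP; ring.
Qed.

End GaussianLaw.

(** * Decay of the correlation between two cells *)

Section Correlation.
Context {R : realType}.
Variables (d : nat) (ell beta : R).
Hypotheses (ell0 : 0 < ell) (beta0 : 0 < beta).
Implicit Types c : cell d.

(** Bound on the probability of visiting [c'] after a visit to [c], for [c] not later than [c']: one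
    heat kernel factor per coordinate, uniform over positions in [c]. *)
Definition fwd_corr c c' : R :=
  \prod_(j < d) pr (glaw ((c'.2 - c.2)%N%:R * beta)) (near_set ell (c'.1 j - c.1 j)).

Definition corr c c' : R :=
  if (c.2 <= c'.2)%N then fwd_corr c c' else fwd_corr c' c.

Lemma corrxx c : corr c c <= 1.
Proof.
rewrite /corr leqnn /fwd_corr; apply: prodr_ile1 => j _.
by rewrite pr_ge0 pr_le1//; exact: measurable_near_set.
Qed.

(** One summand for cells far apart in time and one for cells far apart in space only. *)
Definition corr_const : R := 2 * ell / Num.sqrt beta + 2 * Num.sqrt (8 * d%:R).

Lemma expRN_le_sqrt (u : R) : 0 < u -> expR (- u) <= (Num.sqrt u)^-1.
Proof.
move=> u0; have su : 0 < Num.sqrt u by rewrite sqrtr_gt0.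
rewrite expRN lef_pV2 ?posrE ?expR_gt0//.
apply: le_trans (expR_ge1Dx _).
have := sqr_sqrtr (ltW u0); set v := Num.sqrt u => Ev.
by have := sqr_ge0 (v - 1); nra.
Qed.

Lemma near_set_norm_ge (z : int) (m : nat) (y : R) :
  (2 <= m)%N -> (m <= `|z|)%N -> near_set ell z y -> m%:R * ell <= 2 * `|y|.
Proof.
move=> m2 zm; rewrite /near_set /= in_itv/= intrB intrD => /andP[y1 y2].
have m2R : 2 * ell <= m%:R * ell by rewrite ler_pM2r// ler_nat.
have [{}zm|{}zm] : m%:Z <= z \/ z <= - m%:Z by lia.
  have zR : m%:R * ell <= z%:~R * ell.
    by rewrite ler_pM2r//; rewrite -(ler_int R) in zm.
  have := ler_norm y; move: y1; rewrite mulrBl mul1r => y1 y3; lra.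
have zR : z%:~R * ell <= - m%:R * ell.
  by rewrite ler_pM2r//; rewrite -(ler_int R) rmorphN in zm.
have := ler_norm (- y); move: y2; rewrite normrN mulrDl mul1r => y2 y3.
move: zR; rewrite mulNr => zR; lra.
Qed.

(** Simultaneous cells at this distance give 0. A time lag of at least [m] makes every coordinate of
    order m^(-1/2). For a shorter positive lag some coordinate is at distance at least [m] and
    contributes a Gaussian factor. *)
Lemma fwd_corr_le c c' (m : nat) : (c.2 <= c'.2)%N -> (2 <= m <= cdist c c')%N ->
  fwd_corr c c' <= (corr_const / Num.sqrt m%:R) ^+ d.
Proof.
move=> cc' /andP[m2 mc].
have sb : 0 < Num.sqrt beta by rewrite sqrtr_gt0.
have m0 : 0 < m%:R :> R by rewrite ltr0n; lia.
have sm : 0 < Num.sqrt m%:R :> R by rewrite sqrtr_gt0.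
have k0 : 0 <= corr_const.
  by rewrite /corr_const addr_ge0 ?mulr_ge0 ?sqrtr_ge0 ?invr_ge0 ?ltW.
have far : (c'.2 - c.2 < m)%N -> exists j, (m <= `|c'.1 j - c.1 j|)%N.
  move=> tm; apply: contrapT => /forallNP H.
  have : (cdist c c' <= m.-1)%N.
    apply/cdist_leP; split; last by lia.
    by move=> j; have := H j; lia.
  by lia.
have [tt|tt] := eqVneq c'.2 c.2.
  have [|j jm] := far; first by lia.
  rewrite /fwd_corr (bigD1 j)//= tt subnn mul0r glaw0_near// ?mul0r ?exprn_ge0//.
    by rewrite divr_ge0// sqrtr_ge0.
  by lia.
set s := (c'.2 - c.2)%N%:R * beta.
have t1 : 1 <= (c'.2 - c.2)%N%:R :> R by rewrite ler1n; lia.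
have s0 : 0 < s by rewrite mulr_gt0// (lt_le_trans _ t1).
have ss : 0 < Num.sqrt s by rewrite sqrtr_gt0.
have triv z : pr (glaw s) (near_set ell z) <= 2 * ell * (Num.sqrt s)^-1.
  rewrite -[leRHS]mulr1; apply: glaw_near_le => // y _.
  rewrite -[leRHS]expR0 ler_expR mulNr oppr_le0 divr_ge0 ?sqr_ge0//.
  by rewrite mulrn_wge0// ltW.
have [mt|mt] := leqP m (c'.2 - c.2)%N.
  rewrite /fwd_corr -/s -[d in _ ^+ d]card_ord -prodr_const.
  apply: ler_prod => j _; rewrite pr_ge0/=; apply: le_trans (triv _) _.
  apply: (@le_trans _ _ (2 * ell / Num.sqrt beta / Num.sqrt m%:R)).
    rewrite -[leRHS]mulrA ler_pM2l ?mulr_gt0// -invfM lef_pV2 ?posrE ?mulr_gt0//.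
    rewrite -sqrtrM; last exact: ltW.
    by rewrite ler_sqrt ?(ltW s0)// /s mulrC ler_pM2r// ler_nat.
  by rewrite ler_pM2r ?invr_gt0// /corr_const lerDl mulr_ge0 ?sqrtr_ge0.
have [j0 jm] := far mt.
have d0 : (0 < d)%N by case: (j0); lia.
have dR : 0 < d%:R :> R by rewrite ltr0n.
(* The Gaussian exponent y^2 / (2 s) at |y| = m ell / 2, divided by [d]. *)
pose u := (m%:R * ell) ^+ 2 / (8 * s * d%:R).
have u0 : 0 < u by apply: divr_gt0; [exact/exprn_gt0/mulr_gt0|apply: mulr_gt0 => //; exact: mulr_gt0].
have Hj : pr (glaw s) (near_set ell (c'.1 j0 - c.1 j0)) <=
    2 * ell * (Num.sqrt s)^-1 * expR (- (u * d%:R)).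
  apply: glaw_near_le => // y yz.
  rewrite ler_expR mulNr lerN2.
  have ym : m%:R * ell <= 2 * `|y| by apply: near_set_norm_ge yz.
  have E : u * d%:R = (m%:R * ell) ^+ 2 / 4 / (s *+ 2).
    by rewrite /u; field; rewrite !gt_eqF.
  rewrite E ler_pM2r ?invr_gt0 ?mulrn_wgt0//.
  have : (m%:R * ell) ^+ 2 <= (2 * `|y|) ^+ 2.
    by rewrite ler_sqr ?nnegrE ?mulr_ge0// ltW.
  by rewrite [leRHS]exprMn real_normK ?num_real//; lra.
(* The Gaussian factor of the single far coordinate is shared equally among all [d] factors. *)
apply: (@le_trans _ _ ((2 * ell * (Num.sqrt s)^-1 * expR (- u)) ^+ d)).
  rewrite exprMn -expRM_natr mulNr.
  set A := _ / Num.sqrt s; have -> : A ^+ d = A * A ^+ d.-1 by rewrite -exprS prednK.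
  rewrite /fwd_corr -/s (bigD1 j0)//= mulrAC.
  apply: ler_pM => //; first exact: pr_ge0.
    by apply: prodr_ge0 => j _; exact: pr_ge0.
  have -> : d.-1 = #|[pred j | j != j0]|.
    by rewrite cardC1 card_ord.
  rewrite -prodr_const; apply: ler_prod => j _; rewrite pr_ge0/=; exact: triv.
apply: lerXn2r; rewrite ?nnegrE.
- by rewrite mulr_ge0 ?expR_ge0// mulr_ge0 ?invr_ge0 ?sqrtr_ge0// mulr_ge0// ltW.
- by rewrite divr_ge0// sqrtr_ge0.
(* Trading exp (-u) for u^(-1/2) cancels the time lag, since s u = (m ell)^2 / (8 d). *)
apply: (@le_trans _ _ (2 * ell * (Num.sqrt s)^-1 * (Num.sqrt u)^-1)).
  rewrite ler_pM2l ?expRN_le_sqrt// mulr_gt0 ?invr_gt0// mulr_gt0//.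
have -> : 2 * ell * (Num.sqrt s)^-1 * (Num.sqrt u)^-1 = 2 * Num.sqrt (8 * d%:R) / m%:R.
  rewrite -mulrA -invfM -sqrtrM ?ltW//.
  have e8 : 0 < Num.sqrt (8 * d%:R) :> R by rewrite sqrtr_gt0 mulr_gt0.
  have -> : s * u = (m%:R * ell / Num.sqrt (8 * d%:R)) ^+ 2.
    by rewrite expr_div_n sqr_sqrtr ?mulr_ge0 ?ltW// /u; field; rewrite !gt_eqF.
  rewrite sqrtr_sqr ger0_norm; last by rewrite divr_ge0 ?mulr_ge0 ?ltW.
  by field; rewrite !gt_eqF.
apply: (@le_trans _ _ (2 * Num.sqrt (8 * d%:R) / Num.sqrt m%:R)).
  apply: ler_wpM2l; first by rewrite mulr_ge0 ?sqrtr_ge0.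
  rewrite lef_pV2 ?posrE// -[leRHS]ger0_norm ?(ltW m0)// -sqrtr_sqr ler_sqrt ?sqr_ge0//.
  by rewrite expr2 ler_peMl ?(ltW m0)// ler1n; lia.
by rewrite ler_pM2r ?invr_gt0// /corr_const lerDr divr_ge0 ?mulr_ge0 ?sqrtr_ge0// ltW.
Qed.

Lemma corr_le c c' (m : nat) : (2 <= m <= cdist c c')%N ->
  corr c c' <= (corr_const / Num.sqrt m%:R) ^+ d.
Proof.
rewrite /corr; case: ifPn => cc' m2; first exact: fwd_corr_le.
by apply: fwd_corr_le; [lia|rewrite cdistC].
Qed.

End Correlation.

(** * Brownian increments *)

Section Increments.
Context {R : realType} {dT : measure_display} {T : measurableType dT}.
Variables (P : probability T R) (W : R -> T -> R).
Hypothesis BM : standard_BM P W.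

Lemma BM_measurable s (A : set R) : 0 <= s -> measurable A -> measurable (W s @^-1` A).
Proof. by move=> s0 mA; case: BM => mW _; rewrite -[X in measurable X]setTI; apply: mW. Qed.

Lemma glaw0E (A : set R) : pr (glaw 0) A = `[< A 0 >]%:R.
Proof. by rewrite /glaw eqxx /pr /= indicE; congr (_%:R); rewrite inE. Qed.

Lemma glaw_normal (s : R) (A : set R) : 0 < s ->
  normal_prob 0 (Num.sqrt s) A = (glaw s) A.
Proof. by move=> s0; rewrite /glaw gt_eqF. Qed.

Lemma BM_increment (s u : R) (B : set R) : 0 <= s -> s < u -> measurable B ->
  pr P [set w | B (W u w - W s w)] = pr (glaw (u - s)) B.
Proof.
move=> s0 su mB; case: BM => _ [_ [_ H]].
have := H 1%N (fun i => if i == 0%N then s else u) (fun=> B) s0.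
rewrite big_ord1 /= glaw_normal ?subr_gt0// => E.
rewrite /pr -E; last 2 first.
- by case.
- by [].
by congr (fine (P _)); apply/seteqP; split=> [w Bw i /= | w /(_ 0%N)];
  [case: i | apply].
Qed.

Lemma measurable_two_increments (s u : R) (A B : set R) : 0 <= s -> 0 <= u ->
  measurable A -> measurable B ->
  measurable [set w | A (W s w) /\ B (W u w - W s w)].
Proof.
move=> s0 u0 mA mB.
rewrite (_ : [set w | _] = W s @^-1` A `&` (fun w => W u w - W s w) @^-1` B)//.
apply: measurableI; first exact: BM_measurable.
have mD : measurable_fun setT (fun w => W u w - W s w).
  by case: BM => mW _; apply: measurable_funB; apply: mW.
by rewrite -[X in measurable X]setTI; apply: mD.
Qed.

(** [standard_BM] speaks of strictly increasing times only; the cases u = s and s = 0, where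
    [glaw 0] is a point mass, are settled by hand. *)
Lemma BM_two_increments (s u : R) (A B : set R) : 0 <= s -> s <= u ->
  measurable A -> measurable B ->
  pr P [set w | A (W s w) /\ B (W u w - W s w)] = pr (glaw s) A * pr (glaw (u - s)) B.
Proof.
move=> s0; rewrite le_eqVlt => /predU1P[<-|su] mA mB.
  rewrite subrr glaw0E; case: asboolP => B0; last first.
    rewrite mulr0 (_ : [set w | _] = set0) ?pr_set0//.
    by rewrite -subset0 => w /=; rewrite subrr => -[].
  rewrite mulr1 (_ : [set w | _] = W s @^-1` A); last first.
    by apply/seteqP; split=> w /=; rewrite subrr => // -[].
  move: s0; rewrite le_eqVlt => /predU1P[<-|s0].
    case: BM => _ [W0 _]; rewrite glaw0E; case: asboolP => A0.
      rewrite (_ : _ @^-1` _ = setT) ?pr_setT//.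
      by apply/seteqP; split=> w //= _; rewrite W0.
    rewrite (_ : _ @^-1` _ = set0) ?pr_set0//.
    by rewrite -subset0 => w /=; rewrite W0.
  rewrite -[in RHS](subr0 s) -BM_increment//; congr (pr P).
  by case: BM => _ [W0 _]; apply/seteqP; split=> w /=; rewrite W0 subr0.
case: (BM) => _ [W0 [_ H]]; move: s0; rewrite le_eqVlt => /predU1P[E0|s0].
  rewrite -E0 in su *; rewrite glaw0E -BM_increment//; case: asboolP => A0.
    rewrite mul1r; congr (pr P).
    by apply/seteqP; split=> w /=; rewrite W0 // => -[].
  rewrite mul0r (_ : [set w | _] = set0) ?pr_set0//.
  by rewrite -subset0 => w /=; rewrite W0 => -[].
have := H 2%N (fun i => if i == 0%N then 0 else if i == 1%N then s else u)
  (fun i => if i == 0%N then A else B) (lexx _).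
have su0 : 0 < u - s by rewrite subr_gt0.
rewrite big_ord_recl big_ord1 /= subr0 (glaw_normal A s0) (glaw_normal B su0) => E.
apply: EFin_inj; rewrite EFinM -!prE// -?E.
- congr (P _); apply/seteqP; split=> w /=.
    by move=> [? ?] [|[|i]]//= _; rewrite W0 subr0.
  by move=> Hw; have := Hw 0%N isT; have := Hw 1%N isT; rewrite /= W0 subr0.
- by case=> [|[]].
- by case=> [|[]].
by apply: measurable_two_increments => //; apply: ltW => //; exact: lt_trans su.
Qed.

Lemma BM_marginal (s : R) (A : set R) : 0 <= s -> measurable A ->
  pr P (W s @^-1` A) = pr (glaw s) A.
Proof.
move=> s0 mA; have := @BM_two_increments s s A setT s0 (lexx _) mA measurableT.
rewrite pr_setT mulr1 => <-; congr (pr P).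
by apply/seteqP; split=> w //= [].
Qed.

End Increments.

Section Overlap.
Context {R : realType} {dT : measure_display} {T : measurableType dT}.
Variables (P : probability T R) (W : R -> T -> R) (ell beta : R) (r M : nat).
Hypotheses (BM : standard_BM P W) (ell0 : 0 < ell) (beta0 : 0 < beta) (r0 : (0 < r)%N).

(* A whole grid interval carried into two unit intervals by the same path
   forces the increment of the path into [near_set]; since the inclusion is
   strict this already excludes two different intervals at the same time. *)
Lemma slot_overlap_le (i i' : int) (t t' : nat) (q : 'I_(2 * M)) : (t <= t')%N ->
  pr P (W (t%:R * beta) @^-1` slot ell r i q `&` W (t'%:R * beta) @^-1` slot ell r i' q)
  <= pr (glaw (t%:R * beta)) (slot ell r i q) *
     pr (glaw ((t' - t)%N%:R * beta)) (near_set ell (i' - i)).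
Proof.
move=> tt'; have t0 : 0 <= t%:R * beta by rewrite mulr_ge0// ltW.
have t'0 : 0 <= t'%:R * beta by rewrite mulr_ge0// ltW.
have le_t : t%:R * beta <= t'%:R * beta by rewrite ler_pM2r// ler_nat.
have mn := @measurable_near_set R ell (i' - i).
have ms z := @measurable_slot R ell r M z q.
rewrite natrB// mulrBl -(BM_two_increments BM t0 le_t (ms i) mn).
apply: pr_le.
- by apply: measurableI; apply: (BM_measurable BM) => //; exact: ms.
- exact: (measurable_two_increments BM).
- move=> w [/= S S']; split=> //; have d0 := delta_gt0 ell0 r0.
  case: S S'; rewrite /near_set /= in_itv/= !intrD !intrN => H1 H2 [H3 H4].
  by apply/andP; split; lra.
Qed.

End Overlap.

(** * Poisson configurations on the grid *)

Section SigmaAlgebra.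
Context {R : realType} {dT : measure_display} {T : measurableType dT}.
Variables (I : Type) (Y : I -> T -> R).

Let gen := [set E | exists i B, measurable B /\ E = Y i @^-1` B].

Lemma rv_sigma_measurable A : (forall i, measurable_fun setT (Y i)) ->
  rv_sigma Y A -> measurable A.
Proof.
move=> mY; apply: smallest_sub; first exact: sigma_algebra_measurable.
by move=> _ [i [B [mB ->]]]; rewrite -[X in measurable X]setTI; apply: mY.
Qed.

Lemma rv_sigma_preimage i (B : set R) : measurable B -> rv_sigma Y (Y i @^-1` B).
Proof. by move=> mB; apply: sub_sigma_algebra; exists i, B. Qed.

Lemma rv_sigma_bigcap (F : nat -> set T) :
  (forall i, rv_sigma Y (F i)) -> rv_sigma Y (\bigcap_i F i).
Proof.
move=> HF; have : (forall k, @measurable _ (g_sigma_algebraType gen) (F k)) by [].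
exact: bigcapT_measurable.
Qed.

Lemma rv_sigma_fin_bigcap (J : finType) (F : J -> set T) :
  (forall i, rv_sigma Y (F i)) -> rv_sigma Y [set w | forall i, F i w].
Proof. exact: (@measurable_forall_fin _ (g_sigma_algebraType gen)). Qed.

Lemma rv_sigmaC A : rv_sigma Y A -> rv_sigma Y (~` A).
Proof. exact: (@measurableC _ (g_sigma_algebraType gen)). Qed.

Lemma rv_sigma_set0 : rv_sigma Y set0.
Proof. exact: (@measurable0 _ (g_sigma_algebraType gen)). Qed.

Lemma rv_sigma_atom n (E : 'I_n -> set T) B :
  (forall c, rv_sigma Y (E c)) -> rv_sigma Y (atom E B).
Proof. exact: (@measurable_atom _ (g_sigma_algebraType gen)). Qed.

End SigmaAlgebra.

Section GridBoxes.
Context {R : realType} (d : nat) (ell : R) (r M : nat).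
Hypotheses (ell0 : 0 < ell) (r0 : (0 < r)%N).
Local Notation G := {ffun 'I_d -> 'I_(2 * M)}.
Local Notation delta := (ell / r%:R).

Definition gbox (p : G) : set ('I_d -> R) :=
  box (fun j => gridpt ell r (p j)) (fun j => gridpt ell r (p j) + delta).

Lemma gbox_inj p q x : gbox p x -> gbox q x -> p = q.
Proof.
move=> Hp Hq; apply/ffunP => j; apply: val_inj => /=; apply/eqP.
have d0 := delta_gt0 ell0 r0.
have H (a b : 'I_(2 * M)) (y : R) : gridpt ell r a <= y -> y < gridpt ell r b + delta ->
    (a <= b)%N.
  rewrite /gridpt => H1 H2; have := le_lt_trans H1 H2.
  have -> : (b%:R - M%:R) * delta + delta = (b.+1%:R - M%:R) * delta.
    by rewrite -natr1; ring.
  by rewrite ltr_pM2r// ltrD2r ltr_nat.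
move: (Hp j) (Hq j) => /andP[H1 H2] /andP[H3 H4].
by rewrite eqn_leq (H _ _ _ H1 H4) (H _ _ _ H3 H2).
Qed.

Definition loc (o : option G) (x : 'I_d -> R) : Prop :=
  if o is Some p then gbox p x else forall p, ~ gbox p x.

Lemma loc_inj o o' x : loc o x -> loc o' x -> o = o'.
Proof.
case: o => [p|]; case: o' => [q|] //=; first by move=> Hp Hq; rewrite (gbox_inj Hp Hq).
  by move=> Hp /(_ p).
by move=> /(_ q).
Qed.

Definition locate (x : 'I_d -> R) : option G := [pick p | `[< gbox p x >]].

Lemma loc_locate x : loc (locate x) x.
Proof.
rewrite /locate; case: pickP => [p /asboolP//|H] p Hp.
by have /asboolP := H p.
Qed.

End GridBoxes.

(** * Truncated Poisson sums *)

Section PoissonSums.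
Context {R : realType}.

Lemma exp_partial_le (x : R) B : 0 <= x -> \sum_(i < B) x ^+ i / i`!%:R <= expR x.
Proof.
move=> x0; have nd : nondecreasing_seq (series (exp_coeff x)).
  apply/nondecreasing_seqP => k; rewrite -subr_ge0 seriesSB.
  by rewrite divr_ge0// exprn_ge0.
have := nondecreasing_cvgn_le nd (is_cvg_series_exp_coeff x) B.
by rewrite /series /= big_mkord.
Qed.

Lemma exp_partial_near (x eta : R) : 0 < eta ->
  exists B, expR x - eta <= \sum_(i < B) x ^+ i / i`!%:R.
Proof.
move=> eta0; have /cvgrPdist_le/(_ _ eta0)[B _ /(_ B (leqnn _))] :
  series (exp_coeff x) @ \oo --> expR x := is_cvg_series_exp_coeff x.
rewrite /series /= big_mkord => H; exists B.
by move: H; rewrite ler_distl => /andP[]; rewrite /exp_coeff/=; lra.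
Qed.

Lemma poisson_sum_le (mu u : R) B : 0 < mu -> 0 <= u ->
  \sum_(i < B) poisson_pmf mu i * u ^+ i <= expR (- (mu * (1 - u))).
Proof.
move=> mu0 u0; rewrite /poisson_pmf mu0.
have -> : \sum_(i < B) mu ^+ i / i`!%:R * expR (- mu) * u ^+ i =
    expR (- mu) * \sum_(i < B) (mu * u) ^+ i / i`!%:R.
  by rewrite mulr_sumr; apply: eq_bigr => i _; rewrite exprMn; ring.
rewrite [- (mu * _)](_ : _ = - mu + mu * u); last by ring.
by rewrite expRD ler_pM2l ?expR_gt0// exp_partial_le// mulr_ge0// ltW.
Qed.

Lemma poisson_sum_near (mu eta : R) : 0 < mu -> 0 < eta ->
  exists B, 1 - eta <= \sum_(i < B) poisson_pmf mu i.
Proof.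
move=> mu0 eta0; have e0 : 0 < eta * expR mu by rewrite mulr_gt0// expR_gt0.
have [B HB] := @exp_partial_near mu _ e0.
exists B; rewrite /poisson_pmf mu0 -mulr_suml.
rewrite -(@ler_pM2r _ (expR mu)) ?expR_gt0// -mulrA -expRD addNr expR0 mulr1.
by apply: le_trans HB; lra.
Qed.

Lemma bernoulli_exprn (x : R) N : 0 <= x <= 1 -> 1 - N%:R * (1 - x) <= x ^+ N.
Proof.
move=> /andP[x0 x1]; elim: N => [|N IH]; first by rewrite mul0r subr0 expr0.
have : x * (1 - N%:R * (1 - x)) <= x ^+ N.+1 by rewrite exprS ler_wpM2l.
apply: le_trans; rewrite -natr1.
have : 0 <= N%:R * ((1 - x) * (1 - x)) by rewrite !mulr_ge0// subr_ge0.
lra.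
Qed.

Lemma one_sub_exprn_le (x eta : R) N : 0 <= x <= 1 -> 0 < eta ->
  1 - eta / (N%:R + 1) <= x -> 1 - x ^+ N <= eta.
Proof.
move=> x01 eta0 Hx; have := bernoulli_exprn N x01.
have N0 : 0 < N%:R + 1 :> R by rewrite ltr_wpDl.
have H1 : N%:R * (1 - x) <= N%:R * (eta / (N%:R + 1)) by apply: ler_wpM2l => //; lra.
have H2 : N%:R * (eta / (N%:R + 1)) <= eta.
  by rewrite mulrCA ler_piMr ?(ltW eta0)// ler_pdivrMr// mul1r lerDl.
lra.
Qed.

End PoissonSums.

(** * Measurability of badness *)

Section Model.
Context {R : realType} {dT : measure_display} {T : measurableType dT}.
Variables (P : probability T R) (d : nat) (eps lam ell beta : R).
Variables (X : nat -> 'I_d -> T -> R) (W : nat -> 'I_d -> R -> T -> R).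
Hypothesis beta0 : 0 < beta.
Hypothesis model : PPP_BM P lam X W.

Let BM k j : standard_BM P (W k j). Proof. by case: model. Qed.
Let mX k j : measurable_fun setT (X k j). Proof. by case: model => -[]. Qed.

Lemma cell_time_ge0 (c : cell d) : 0 <= c.2%:R * beta.
Proof. by rewrite mulr_ge0// ltW. Qed.

Lemma measurable_position k j (c : cell d) :
  measurable_fun setT (fun w => X k j w + W k j (c.2%:R * beta) w).
Proof.
apply: measurable_funD => //; have [mW _] := BM k j; apply: mW; exact: cell_time_ge0.
Qed.

Lemma countable_exists_measurable (I : countType) (F : I -> set T) :
  (forall i, measurable (F i)) -> measurable [set w | exists i, F i w].
Proof.
move=> mF; rewrite (_ : [set w | _] = \bigcup_(i in [set: I]) F i); last first.
  by apply/seteqP; split=> w [i]; [exists i|move=> _ ?; exists i].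
by apply: countable_bigcupT_measurable => //; exact: countableP.
Qed.

(** A good cell is witnessed by a finite list of labels, and there are countably many such lists. *)
Lemma measurable_E_good (c : cell d) : measurable [set w | E_good eps lam ell beta X W c w].
Proof.
apply: (countable_exists_measurable (F := fun s => [set w | [/\ uniq s,
  forall k, k \in s -> cube ell c.1 (position X W k (c.2%:R * beta) w) &
    (1 - eps) * lam * ell ^+ d <= (size s)%:R]])) => s.
have [us|us] := boolP (uniq s); last first.
  by rewrite (_ : [set w | _] = set0)// -subset0 => w [].
have [ss|ss] := boolP ((1 - eps) * lam * ell ^+ d <= (size s)%:R); last first.
  by rewrite (_ : [set w | _] = set0)// -subset0 => w [].
rewrite (_ : [set w | _] = \big[setI/setT]_(k <- s) \big[setI/setT]_j
   ((fun w => X k j w + W k j (c.2%:R * beta) w) @^-1`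
     `[(c.1 j)%:~R * ell, (c.1 j + 1)%:~R * ell]%classic)).
  apply: bigsetI_measurable => k _; apply: bigsetI_measurable => j _.
  by rewrite -[X in measurable X]setTI; apply: measurable_position.
apply/seteqP; split=> w; rewrite -bigcap_seq.
  move=> [_ H _] k ks; rewrite -bigcap_seq => j _ /=; rewrite in_itv/=.
  exact: H.
move=> H; split=> // k ks j; have := H k ks; rewrite -bigcap_seq => /(_ j).
by rewrite /= mem_index_enum in_itv/=; apply.
Qed.

Lemma measurable_bad (c : cell d) : measurable [set w | bad eps lam ell beta X W c w].
Proof. exact: (measurableC (measurable_E_good c)). Qed.

End Model.

(** * Probability that all cells of a finite family are bad *)

Section LowDensity.
Context {R : realType} {dT : measure_display} {T : measurableType dT}.
Variables (P : probability T R) (d : nat) (eps lam ell beta : R).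
Variables (X : nat -> 'I_d -> T -> R) (W : nat -> 'I_d -> R -> T -> R).
Hypotheses (d0 : (0 < d)%N) (lam0 : 0 < lam) (ell0 : 0 < ell) (beta0 : 0 < beta).
Hypothesis model : PPP_BM P lam X W.
Variables (n : nat) (S : 'I_n -> cell d) (r M : nat) (theta : R).
Hypotheses (r0 : (0 < r)%N) (theta0 : 0 <= theta).

Local Notation G := {ffun 'I_d -> 'I_(2 * M)}.
Local Notation delta := (ell / r%:R).
Local Notation gb := (@gbox R d ell r M).

Let BM k j : standard_BM P (W k j). Proof. by case: model. Qed.
Let mX k j : measurable_fun setT (X k j). Proof. by case: model => -[]. Qed.

Let Xs (kj : nat * 'I_d) := X kj.1 kj.2.

(** [None] means outside the grid. Labels from [K] on are declared outside, so finite data prescribe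
    the boxes of all nodes. *)
Definition ext K (a : {ffun 'I_K -> option G}) (k : nat) : option G :=
  if insub k is Some k' then a k' else None.

Lemma ext_ord K (a : {ffun 'I_K -> option G}) (k : 'I_K) : ext a k = a k.
Proof. by rewrite /ext valK. Qed.

Lemma ext_ge K (a : {ffun 'I_K -> option G}) k : (K <= k)%N -> ext a k = None.
Proof. by move=> Kk; rewrite /ext insubN// -leqNgt. Qed.

Definition configuration K (a : {ffun 'I_K -> option G}) : set T :=
  [set w | forall k, @loc R d ell r M (ext a k) (fun j => X k j w)].

Lemma rv_sigma_gbox k p : rv_sigma Xs [set w | gb p (fun j => X k j w)].
Proof.
pose F j := Xs (k, j) @^-1` `[gridpt ell r (p j), gridpt ell r (p j) + delta[%classic.
rewrite (_ : [set w | _] = [set w | forall j, F j w]).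
  by apply: rv_sigma_fin_bigcap => j; apply: rv_sigma_preimage; exact: measurable_itv.
by apply/seteqP; split=> w H j; have := H j; rewrite /F /= in_itv/=.
Qed.

Lemma rv_sigma_configuration K (a : {ffun 'I_K -> option G}) :
  rv_sigma Xs (configuration a).
Proof.
rewrite (_ : configuration a = \bigcap_k [set w | @loc R d ell r M (ext a k) (fun j => X k j w)]).
  apply: rv_sigma_bigcap => k; case: (ext a k) => [p|]; first exact: rv_sigma_gbox.
  apply: (@rv_sigma_fin_bigcap _ _ _ _ Xs _ (fun p => ~` [set w | gb p (fun j => X k j w)])).
  by move=> p; apply: rv_sigmaC; exact: rv_sigma_gbox.
by apply/seteqP; split=> w H k; [move=> _|]; apply: H.
Qed.

Lemma measurable_configuration K (a : {ffun 'I_K -> option G}) :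
  measurable (configuration a).
Proof.
apply: (rv_sigma_measurable (Y := Xs)); last exact: rv_sigma_configuration.
by move=> kj; exact: mX.
Qed.

Lemma configuration_inj K (a a' : {ffun 'I_K -> option G}) w :
  configuration a w -> configuration a' w -> a = a'.
Proof.
move=> H H'; apply/ffunP => k.
by have := loc_inj ell0 r0 (H k) (H' k); rewrite !ext_ord.
Qed.

Definition occ (c : cell d) j (q : 'I_(2 * M)) : R :=
  pr (glaw (c.2%:R * beta)) (slot ell r (c.1 j) q).

Definition fwd_occ2 (c c' : cell d) j q : R :=
  occ c j q * pr (glaw ((c'.2 - c.2)%N%:R * beta)) (near_set ell (c'.1 j - c.1 j)).

Definition occ2 (c c' : cell d) j q : R :=
  if (c.2 <= c'.2)%N then fwd_occ2 c c' j q else fwd_occ2 c' c j q.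

(** Expected number of counted visits of a node that starts in the box [p]; [second] bounds the
    second moment. Summed over boxes they lead to the volume of the cells and to the energy. *)
Definition mean (p : G) : R := \sum_c \prod_j occ (S c) j (p j).

Definition second (p : G) : R := \sum_c \sum_c' \prod_j occ2 (S c) (S c') j (p j).

Definition hit (o : option G) k j (c : 'I_n) : set T :=
  if o is Some p then W k j ((S c).2%:R * beta) @^-1` slot ell r ((S c).1 j) (p j)
  else set0.

Definition mgf_bound (o : option G) : R :=
  if o is Some p then 1 - theta * mean p + theta ^+ 2 * second p else 1.

Lemma measurable_hit o k j c : measurable (hit o k j c).
Proof.
case: o => [p|] /=; last exact: measurable0.
apply: (BM_measurable (BM k j)); first exact: cell_time_ge0.
exact: measurable_slot.
Qed.

Lemma hit_overlap_le p k j c c' :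
  pr P (hit (Some p) k j c `&` hit (Some p) k j c') <= occ2 (S c) (S c') j (p j).
Proof.
rewrite /occ2; case: ifPn => cc'; first exact: (slot_overlap_le (BM k j)).
by rewrite setIC; apply: (slot_overlap_le (BM k j)) => //; lia.
Qed.

Lemma laplace_hit_le o k : laplace P (hit o k) theta <= mgf_bound o.
Proof.
apply: le_trans (laplace_le _ theta0 _) _ => [j c|]; first exact: measurable_hit.
case: o => [p|] /=.
  rewrite lerD//; last first.
    apply: ler_wpM2l; first exact: sqr_ge0.
    apply: ler_sum => c _; apply: ler_sum => c' _; apply: ler_prod => j _.
    by rewrite pr_ge0 hit_overlap_le.
  rewrite lerD2l lerN2; apply: ler_wpM2l => //; apply: ler_sum => c _.
  apply: ler_prod => j _; rewrite pr_ge0/= (BM_marginal (BM k j))//.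
    exact: cell_time_ge0.
  exact: measurable_slot.
(* An empty product would be 1, so this is where [d0] enters. *)
have z : \prod_(j < d) (0 : R) = 0 by rewrite (bigD1 (Ordinal d0))//= mul0r.
rewrite big1 ?mulr0 ?subr0 => [|c _]; last first.
  by rewrite -[RHS]z; apply: eq_bigr => j _; rewrite pr_set0.
rewrite big1 ?mulr0 ?addr0 => [//|c _]; rewrite big1// => c' _.
by rewrite -[RHS]z; apply: eq_bigr => j _; rewrite set0I pr_set0.
Qed.

(** The quadratic expression dominates a Laplace transform; the label 0 is arbitrary. *)
Lemma mgf_bound_ge0 o : 0 <= mgf_bound o.
Proof. exact: le_trans (laplace_ge0 _ _ _) (laplace_hit_le o 0). Qed.

(** The configuration is an event of the initial positions and each atom an event of one Brownian
    coordinate, so the independence of the model applies to the finite family [J]. *)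
Lemma hits_independent K (a : {ffun 'I_K -> option G}) (b : 'I_K -> 'I_d -> {set 'I_n}) :
  pr P (configuration a `&` [set w | forall k j, atom (hit (a k) k j) (b k j) w]) =
  pr P (configuration a) * \prod_k \prod_j pr P (atom (hit (a k) k j) (b k j)).
Proof.
have [_ _ ind] := model.
pose A (o : option (nat * 'I_d)) : set T := match o with
  | None => configuration a
  | Some kj => if insub kj.1 is Some k then atom (hit (a k) kj.1 kj.2) (b k kj.2) else setT
  end.
pose J : seq (option (nat * 'I_d)) :=
  None :: [seq Some (val kj.1, kj.2) | kj <- index_enum {: 'I_K * 'I_d}].
have uJ : uniq J.
  rewrite /J /=; apply/andP; split; first by apply/mapP => -[].
  rewrite map_inj_uniq ?index_enum_uniq// => -[k j] [k' j'] /= [kk' ->].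
  by congr pair; apply: val_inj.
have := ind J A uJ; rewrite big_cons big_map => E.
have mA kj : measurable (A (Some kj)).
  case: kj => k j; rewrite /A /=; case: insubP => //= k' _ _.
  by apply: measurable_atom => c; exact: measurable_hit.
apply: EFin_inj; rewrite EFinM -!prE; last 2 first.
- exact: measurable_configuration.
- apply: measurableI; first exact: measurable_configuration.
  apply: (@measurable_forall_fin _ _ _
    (fun k => [set w | forall j, atom (hit (a k) k j) (b k j) w])) => k.
  apply: (@measurable_forall_fin _ _ _ (fun j => atom (hit (a k) k j) (b k j))) => j.
  by apply: measurable_atom => c; exact: measurable_hit.
rewrite (_ : _ `&` _ = \bigcap_(i in [set` J]) A i); last first.
  apply/seteqP; split=> w.
    move=> [cw Hw] [kj|]//=; rewrite inE/= => /mapP[[k j] _ [->]] /=.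
    by rewrite valK; exact: Hw.
  move=> Hw; split=> [|k j]; first by apply: (Hw None); rewrite /= mem_head.
  have := Hw (Some (val k, j)); rewrite /A /= valK; apply.
  rewrite inE /=; apply/mapP; exists (k, j) => //; exact: mem_index_enum.
rewrite E; last first.
  move=> [[k j]|] _ /=; last exact: rv_sigma_configuration.
  case: insubP => /= [k' _ kk'|_]; last first.
    by rewrite -setC0; apply: rv_sigmaC; exact: rv_sigma_set0.
  apply: rv_sigma_atom => c; case: (a k') => [p|] /=; last exact: rv_sigma_set0.
  have t0 := @cell_time_ge0 R d beta beta0 (S c).
  exact: (@rv_sigma_preimage _ _ _ _ (fun s : {s : R | 0 <= s} => W k j (sval s))
    (exist (fun s : R => is_true (0 <= s)) _ t0) _ (measurable_slot _ _ _ _)).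
congr (_ * _)%E; rewrite pair_bigA /= -prodEFin; apply: eq_bigr => -[k j] _ /=.
by rewrite valK prE//; apply: measurable_atom => c; exact: measurable_hit.
Qed.


Local Notation thr := ((1 - eps) * lam * ell ^+ d).

Definition all_bad : set T := [set w | forall c, bad eps lam ell beta X W (S c) w].

Lemma measurable_all_bad : measurable all_bad.
Proof.
apply: (@measurable_forall_fin _ _ _ (fun c => [set w | bad eps lam ell beta X W (S c) w])).
by move=> c; exact: (measurable_bad eps ell beta0 model).
Qed.

(** A hit carries the whole box of the node into the cell, so the counted nodes are in the cell and
    reaching the threshold would make it good. *)
Lemma bad_hits_le K (a : {ffun 'I_K -> option G}) w c : configuration a w ->
  bad eps lam ell beta X W (S c) w ->
  \sum_k [forall j, `[< hit (a k) k j c w >]]%:R <= thr.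
Proof.
move=> aw bw; rewrite leNgt; apply/negP => /ltW H; apply: bw.
pose Q (k : 'I_K) := [forall j, `[< hit (a k) k j c w >]].
exists [seq val k | k <- enum Q]; split.
- by rewrite map_inj_uniq ?enum_uniq//; exact: val_inj.
- move=> _ /mapP[k + ->]; rewrite mem_enum => /forallP Qk j.
  have := aw k; rewrite ext_ord; have /asboolP := Qk j.
  case: (a k) => [p|]//= [H1 H2] /(_ j) /andP[H3 H4].
  by rewrite /position; apply/andP; split; lra.
- apply: le_trans H _; rewrite size_map -cardE -sum1_card natr_sum.
  by rewrite [leRHS]big_mkcond/=; apply: ler_sum => k _; rewrite unfold_in /Q; case: ifP.
Qed.

Lemma configuration_bad_le K (a : {ffun 'I_K -> option G}) :
  pr P (configuration a `&` all_bad) <=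
  pr P (configuration a) * expR (theta * (n%:R * thr)) * \prod_k mgf_bound (a k).
Proof.
apply: (@le_trans _ _ (pr P (configuration a) * expR (theta * (n%:R * thr)) *
    \prod_k laplace P (hit (a k) k) theta)).
  apply: (@chernoff_lower _ _ _ _ _ _ _ (fun k : 'I_K => hit (a k) k)) => //.
  - by move=> k j c; exact: measurable_hit.
  - exact: measurable_configuration.
  - by apply: measurableI; [exact: measurable_configuration|exact: measurable_all_bad].
  - exact: hits_independent.
  - move=> w [aw bw]; split=> //; rewrite exchange_big/=.
    apply: (@le_trans _ _ (\sum_(c < n) thr)); last first.
      by rewrite sumr_const card_ord mulr_natl.
    by apply: ler_sum => c _; apply: bad_hits_le.
apply: ler_wpM2l; first by rewrite mulr_ge0 ?pr_ge0 ?expR_ge0.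
by apply: ler_prod => k _; rewrite laplace_ge0 laplace_hit_le.
Qed.

Definition cnt K (a : {ffun 'I_K -> option G}) (p : G) : nat := #|[pred k | a k == Some p]|.

(** The bound sees the configuration only through its box counts, whose law is Poisson; this removes
    the labels. *)
Lemma prod_mgf_bound K (a : {ffun 'I_K -> option G}) :
  \prod_k mgf_bound (a k) = \prod_p mgf_bound (Some p) ^+ cnt a p.
Proof.
transitivity (\prod_k \prod_p (if a k == Some p then mgf_bound (Some p) else 1)).
  apply: eq_bigr => k _; rewrite -big_mkcond/=; case: (a k) => [p|].
    by rewrite (big_pred1 p)// => q /=; rewrite eq_sym; apply/eqP/eqP => [[]|->].
  by rewrite big_pred0.
rewrite exchange_big/=; apply: eq_bigr => p _.
by rewrite -big_mkcond/= prodr_const.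
Qed.

Definition counts (nn : G -> nat) : set T :=
  [set w | forall p, count_eq X (gb p) (nn p) w].

Definition confined K : set T :=
  [set w | forall k, (K <= k)%N -> forall p, ~ gb p (fun j => X k j w)].

Lemma locate_some p x : @locate R d ell r M x = Some p <-> gb p x.
Proof.
split=> [H|H]; first by have := @loc_locate R d ell r M x; rewrite H.
exact: (loc_inj ell0 r0 (@loc_locate R d ell r M x) (H : loc ell r (Some p) x)).
Qed.

(** For fixed [K] this is a finite disjoint union of configurations. [counts] is the increasing
    limit in [K], since finite counts leave only finitely many labels in the grid. *)
Lemma counts_confinedE K (nn : G -> nat) : counts nn `&` confined K =
  [set w | exists2 a : {ffun 'I_K -> option G}, [forall p, cnt a p == nn p] & configuration a w].
Proof.
apply/seteqP; split=> w.
  move=> [cw fw]; exists [ffun k : 'I_K => locate ell r M (fun j => X k j w)].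
    apply/forallP => p; have [s [us <- Hs]] := cw p.
    rewrite /cnt cardE -(size_map val); apply/eqP/perm_size/uniq_perm => //.
      by rewrite map_inj_uniq ?enum_uniq//; exact: val_inj.
    move=> k; apply/mapP/idP => [[k' + ->]|ks].
      by rewrite mem_enum inE ffunE => /eqP/locate_some/Hs.
    have kK : (k < K)%N.
      by rewrite ltnNge; apply/negP => Kk; apply: (fw k Kk p); apply/Hs.
    exists (Ordinal kK) => //; rewrite mem_enum inE ffunE.
    by apply/eqP/locate_some/Hs.
  move=> k; have [kK|Kk] := ltnP k K; last by rewrite ext_ge//; exact: fw.
  by rewrite (ext_ord _ (Ordinal kK)) ffunE; exact: loc_locate.
move=> [a /forallP ca aw]; split.
  move=> p; exists [seq val k | k : 'I_K <- enum [pred k | a k == Some p]]; split.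
  - by rewrite map_inj_uniq ?enum_uniq//; exact: val_inj.
  - by rewrite size_map -cardE; exact/eqP/ca.
  - move=> k; split=> [pk|/mapP[k' + ->]]; last first.
      by rewrite mem_enum inE => /eqP ak; have := aw k'; rewrite ext_ord ak.
    have E : ext a k = Some p by exact: (loc_inj ell0 r0 (aw k) (pk : loc ell r (Some p) _)).
    have kK : (k < K)%N by rewrite ltnNge; apply/negP => /(@ext_ge _ a); rewrite E.
    apply/mapP; exists (Ordinal kK) => //.
    by rewrite mem_enum inE -(ext_ord a) /= E.
by move=> k Kk; have := aw k; rewrite ext_ge.
Qed.

Lemma confinedS K w : confined K w -> confined K.+1 w.
Proof. by move=> H k Kk; apply: H; exact: ltnW. Qed.

Lemma counts_confined nn w : counts nn w -> exists K, confined K w.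
Proof.
move=> cw; have /choice[f Hf] : forall p, exists K, forall k, gb p (fun j => X k j w) -> (k < K)%N.
  move=> p; have [s [_ _ Hs]] := cw p; exists (\max_(k <- s) k).+1 => k /Hs ks.
  by rewrite ltnS (big_rem k)//= leq_maxl.
exists (\max_p f p) => k Kk p /Hf; apply/negP; rewrite -leqNgt.
by apply: leq_trans Kk; exact: leq_bigmax.
Qed.

Lemma measurable_counts_confined K nn : measurable (counts nn `&` confined K).
Proof.
rewrite counts_confinedE.
rewrite (_ : [set w | _] = \big[setU/set0]_(a : {ffun 'I_K -> option G} |
   [forall p, cnt a p == nn p]) configuration a).
  by apply: bigsetU_measurable => a _; exact: measurable_configuration.
apply/seteqP; split=> w; rewrite -bigcup_seq_cond.
  by move=> [a ca aw]; exists a => //=; rewrite mem_index_enum.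
by move=> [a /= /andP[_ ca] aw]; exists a.
Qed.

Lemma measurable_counts nn : measurable (counts nn).
Proof.
rewrite (_ : counts nn = \bigcup_K (counts nn `&` confined K)).
  by apply: bigcupT_measurable => K; exact: measurable_counts_confined.
apply/seteqP; split=> w; last by move=> [K _ []].
by move=> cw; have [K cK] := counts_confined cw; exists K.
Qed.

Lemma counts_bad_le (nn : G -> nat) :
  pr P (counts nn `&` all_bad) <=
  pr P (counts nn) * expR (theta * (n%:R * thr)) * \prod_p mgf_bound (Some p) ^+ nn p.
Proof.
set C := expR _; set U := \prod_p _.
have U0 : 0 <= U by apply: prodr_ge0 => p _; exact/exprn_ge0/mgf_bound_ge0.
have C0 : 0 <= C by exact: expR_ge0.
rewrite (_ : _ `&` _ = \bigcup_K (counts nn `&` confined K `&` all_bad)); last first.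
  apply/seteqP; split=> w; last by move=> [K _ [[]]].
  by move=> [cw bw]; have [K cK] := counts_confined cw; exists K.
have mC K := measurable_counts_confined K nn.
apply: pr_bigcup_nondecr_le => [K|K w [[? /confinedS ?] ?]|K].
- by apply: measurableI => //; exact: measurable_all_bad.
- by split.
apply: (@le_trans _ _ (pr P (counts nn `&` confined K) * C * U)); last first.
  do 2 apply: ler_wpM2r => //; apply: pr_le => //; exact: measurable_counts.
rewrite counts_confinedE -pr_partition; last 2 first.
- by move=> a; exact: measurable_configuration.
- by move=> a a' w; exact: configuration_inj.
apply: (@le_trans _ _ (\sum_(a : {ffun 'I_K -> option G} | [forall p, cnt a p == nn p])
   pr P (configuration a `&` all_bad))).
  apply: pr_exists_fin_le.
  - by move=> a; apply: measurableI; [exact: measurable_configuration|exact: measurable_all_bad].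
  - rewrite -counts_confinedE; apply: measurableI => //; exact: measurable_all_bad.
  - by move=> w [[a ca aw] bw]; exists a.
rewrite !mulr_suml; apply: ler_sum => a /forallP ca.
apply: le_trans (configuration_bad_le a) _; rewrite -/C prod_mgf_bound.
rewrite (eq_bigr (fun p => mgf_bound (Some p) ^+ nn p))// => p _.
by rewrite (eqP (ca p)).
Qed.

Local Notation mu := (lam * delta ^+ d).

Lemma counts_prob (nn : G -> nat) : pr P (counts nn) = \prod_p poisson_pmf mu (nn p).
Proof.
have [[_ H] _ _] := model.
have := H #|{: G}| (fun p j => gridpt ell r ((enum_val p : G) j))
   (fun p j => gridpt ell r ((enum_val p : G) j) + delta) (fun p => nn (enum_val p)).
rewrite (_ : \bigcap_(p in _) _ = counts nn); last first.
  apply/seteqP; split=> w cw p; last by move=> _; exact: cw.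
  by have := cw (enum_rank p) I; rewrite enum_rankK.
move=> E; apply: EFin_inj; rewrite -prE; last exact: measurable_counts.
rewrite E.
- rewrite prodEFin; congr EFin.
  rewrite [RHS](reindex (fun i : 'I_#|{: G}| => enum_val i : G))/=; last first.
    exists enum_rank => p _; [exact: enum_valK|exact: enum_rankK].
  apply: eq_bigr => i _; congr (poisson_pmf (lam * _) _).
  rewrite (eq_bigr (fun=> delta)) ?prodr_const ?card_ord// => j _.
  by rewrite [X in X - _]addrC addrK.
- by move=> p j; rewrite ltrDl delta_gt0.
- move=> p q pq; rewrite -subset0 => x [Hp Hq].
  have := gbox_inj ell0 r0 (p := enum_val p) (q := enum_val q) Hp Hq.
  by move/enum_val_inj/eqP; rewrite (negbTE pq).
Qed.

(** Poisson Laplace functional by hand: independent Poisson counts turn the product of powers into a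
    product of generating functions. Counts are truncated at [B] to keep sums finite, with total
    error [eta]. *)
Lemma all_bad_le : pr P all_bad <=
  expR (theta * (n%:R * thr)) * \prod_p expR (- (mu * (1 - mgf_bound (Some p)))).
Proof.
set C := expR _; set V := \prod_p _.
have mu0 : 0 < mu by rewrite mulr_gt0// exprn_gt0// delta_gt0.
apply/ler_addgt0Pr => eta eta0.
have N0 : 0 < #|{: G}|%:R + 1 :> R by rewrite ltr_wpDl.
(* With N boxes, each count reaches [B] with probability at most eta / (N + 1). *)
have [B HB] := poisson_sum_near mu0 (divr_gt0 eta0 N0).
pose cf (f : {ffun G -> 'I_B}) := counts (fun p => f p : nat).
pose U := [set w | exists2 f : {ffun G -> 'I_B}, true & cf f w].
have mU : measurable U.
  rewrite /U (_ : [set w | _] = \big[setU/set0]_(f : {ffun G -> 'I_B}) cf f).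
    by apply: bigsetU_measurable => f _; exact: measurable_counts.
  apply/seteqP; split=> w; rewrite -bigcup_seq.
    by move=> [f _ fw]; exists f => //=; rewrite mem_index_enum.
  by move=> [f _ fw]; exists f.
have prU : pr P U = (\sum_(i < B) poisson_pmf mu i) ^+ #|{: G}|.
  rewrite /U -pr_partition.
  - under eq_bigr do rewrite /cf counts_prob.
    by rewrite -(bigA_distr_bigA (fun=> fun i : 'I_B => poisson_pmf mu i)) prodr_const.
  - by move=> f; exact: measurable_counts.
  - move=> f f' w fw f'w; apply/ffunP => p; apply: val_inj => /=.
    have [s [us <- Hs]] := fw p; have [s' [us' <- Hs']] := f'w p.
    apply/perm_size/uniq_perm => // k.
    by apply/idP/idP => [/Hs/Hs'|/Hs'/Hs].
apply: (@le_trans _ _ (pr P ((U `&` all_bad) `|` ~` U))).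
  apply: pr_le; first exact: measurable_all_bad.
    by apply: measurableU; [apply: measurableI => //; exact: measurable_all_bad|exact: measurableC].
  by move=> w bw; have [?|?] := pselect (U w); [left|right].
apply: le_trans (pr_setU_le _ _ _) _.
- by apply: measurableI => //; exact: measurable_all_bad.
- exact: measurableC.
apply: lerD; last first.
  rewrite pr_setC// prU.
  set x := \sum_(i < B) _ in HB *.
  have x01 : 0 <= x <= 1.
    apply/andP; split; first by apply: sumr_ge0 => i _; exact: poisson_pmf_ge0.
    have := poisson_sum_le B mu0 (@ler01 R); rewrite subrr mulr0 oppr0 expR0.
    by under eq_bigr do rewrite expr1n mulr1.
  exact: one_sub_exprn_le.
apply: (@le_trans _ _ (\sum_(f : {ffun G -> 'I_B}) pr P (cf f `&` all_bad))).
  apply: pr_exists_fin_le.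
  - by move=> f; apply: measurableI; [exact: measurable_counts|exact: measurable_all_bad].
  - by apply: measurableI => //; exact: measurable_all_bad.
  - by move=> w [[f _ fw] bw]; exists f.
apply: (@le_trans _ _ (\sum_(f : {ffun G -> 'I_B}) C *
    \prod_p (poisson_pmf mu (f p) * mgf_bound (Some p) ^+ f p))).
  apply: ler_sum => f _; apply: le_trans (counts_bad_le (fun p => f p : nat)) _.
  by rewrite -/C counts_prob big_split/= mulrAC mulrC.
rewrite -mulr_sumr; apply: ler_wpM2l; first exact: expR_ge0.
rewrite -(bigA_distr_bigA (fun p (i : 'I_B) => poisson_pmf mu i * mgf_bound (Some p) ^+ i)).
apply: ler_prod => p _; apply/andP; split.
  by apply: sumr_ge0 => i _; rewrite mulr_ge0 ?poisson_pmf_ge0// exprn_ge0// mgf_bound_ge0.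
exact/poisson_sum_le/mgf_bound_ge0.
Qed.

End LowDensity.

(** * Exponential bound for a family of small energy *)

Section SkeletonBound.
Context {R : realType} {dT : measure_display} {T : measurableType dT}.
Variables (P : probability T R) (d : nat) (eps lam ell beta : R).
Variables (X : nat -> 'I_d -> T -> R) (W : nat -> 'I_d -> R -> T -> R).
Hypotheses (d0 : (0 < d)%N) (lam0 : 0 < lam) (ell0 : 0 < ell) (beta0 : 0 < beta).
Hypothesis model : PPP_BM P lam X W.
Variables (n : nat) (S : 'I_n -> cell d).

Let expr_prod_ord (y : R) : y ^+ d = \prod_(j < d) y.
Proof. by rewrite prodr_const card_ord. Qed.

(** Summing [occ] over the grid gives at most [r] per coordinate, hence at most the volume [ell ^ d]
    after weighting by the mesh. This reflects the invariance of the intensity under the motion and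
    leaves [corr]. *)
Lemma second_sum_le (r M : nat) : (0 < r)%N ->
  (ell / r%:R) ^+ d * \sum_p second ell beta S r (M := M) p <=
  ell ^+ d * \sum_c \sum_c' corr ell beta (S c) (S c').
Proof.
move=> r0; have de0 := delta_gt0 ell0 r0.
have rR : r%:R != 0 :> R by rewrite pnatr_eq0 -lt0n.
have fwd c c' : (ell / r%:R) ^+ d * \sum_(p : {ffun 'I_d -> 'I_(2 * M)})
    \prod_j fwd_occ2 ell beta r c c' j (p j) <= ell ^+ d * fwd_corr ell beta c c'.
  rewrite -(bigA_distr_bigA (fun j q => fwd_occ2 ell beta r c c' j q)).
  rewrite /fwd_corr !expr_prod_ord -!big_split/=.
  apply: ler_prod => j _; apply/andP; split.
    by rewrite mulr_ge0 ?(ltW de0)// sumr_ge0// => q _; rewrite mulr_ge0 ?pr_ge0.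
  rewrite -mulr_suml mulrA; apply: ler_wpM2r; first exact: pr_ge0.
  rewrite -[leRHS](mulfVK rR ell) ler_pM2l//.
  exact: slot_sum_le.
rewrite /second exchange_big/= !mulr_sumr; apply: ler_sum => c _.
rewrite exchange_big/= !mulr_sumr; apply: ler_sum => c' _.
by rewrite /corr /occ2; case: ifP => _; exact: fwd.
Qed.

(** Per coordinate one slot out of [r] and a fraction [eta] of the mass are lost; [M] is large
    enough for all cells at once. *)
Lemma mean_sum_ge (r : nat) (eta : R) : (0 < r)%N -> 0 < eta < 1 ->
  exists M, n%:R * (ell * (r.-1%:R / r%:R) * (1 - eta)) ^+ d <=
    (ell / r%:R) ^+ d * \sum_p mean ell beta S r (M := M) p.
Proof.
move=> r0 /andP[eta0 eta1]; have de0 := delta_gt0 ell0 r0.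
have /choice[f Hf] : forall cj : 'I_n * 'I_d, exists M0, forall M, (M0 <= M)%N ->
    r.-1%:R * (1 - eta) <= \sum_q occ ell beta r (M := M) (S cj.1) cj.2 q.
  by move=> cj; exact: slot_sum_ge.
exists (\max_cj f cj).
rewrite /mean exchange_big/= mulr_sumr -[n in n%:R]card_ord -sum1_card natr_sum mulr_suml.
apply: ler_sum => c _; rewrite mul1r.
rewrite -(bigA_distr_bigA (fun j q => occ ell beta r (S c) j q)).
rewrite !expr_prod_ord -!big_split/=.
apply: ler_prod => j _; apply/andP; split.
  by rewrite !mulr_ge0 ?invr_ge0 ?(ltW ell0)//; lra.
rewrite (_ : ell * _ * _ = ell / r%:R * (r.-1%:R * (1 - eta))); last by ring.
rewrite ler_pM2l//; apply: (Hf (c, j)); exact: (leq_bigmax (c, j)).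
Qed.

Lemma skeleton_bad_le (G0 : R) : 0 < eps < 1 -> 1 <= G0 ->
  \sum_c \sum_c' corr ell beta (S c) (S c') <= n%:R * G0 ->
  pr P (all_bad eps lam ell beta X W S) <=
  expR (- (lam * ell ^+ d * eps ^+ 2 / (16 * G0) * n%:R)).
Proof.
move=> /andP[eps0 eps1] G1 HG.
have G0p : 0 < G0 by lra.
(* Maximiser of theta eps / 2 - theta^2 G0, with value eps^2 / (16 G0). *)
pose theta := eps / (4 * G0).
have t0 : 0 < theta by rewrite divr_gt0// mulr_gt0.
have dR : 0 < d%:R :> R by rewrite ltr0n.
(* With eta = 1 / r the mean keeps a factor (1 - 1/r)^(2d) >= 1 - 2d/r, so this [r] costs at most
   eps / 2, half of the deficit of a bad cell. *)
have [r rR r2N] : exists2 r : nat, 4 * d%:R / eps <= r%:R & (2 <= r)%N.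
  exists (Num.truncn (4 * d%:R / eps)).+2 => //.
  by apply: ltW; apply: lt_trans (truncnS_gt _) _; rewrite ltr_nat.
have rN : (0 < r)%N by exact: ltnW.
have r2 : 2 <= r%:R :> R by rewrite ler_nat.
have r0 : 0 < r%:R :> R by lra.
pose eta : R := r%:R^-1.
have eta0 : 0 < eta by rewrite invr_gt0.
have eta1 : eta <= 2^-1 by rewrite lef_pV2 ?posrE.
have [|M HM] := @mean_sum_ge r eta rN; first by rewrite eta0/=; lra.
have HS := @second_sum_le r M rN.
pose x := (r.-1%:R / r%:R) * (1 - eta).
have {}HM : n%:R * (ell ^+ d * x ^+ d) <=
    (ell / r%:R) ^+ d * \sum_p mean ell beta S r (M := M) p.
  by move: HM; rewrite -[ell * _ * _]mulrA exprMn.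
have Ex : x = (1 - eta) ^+ 2.
  rewrite /x -subn1 natrB// mulrBl mulfV ?gt_eqF// mul1r expr2.
  by rewrite -/eta.
have xd : 1 - eps / 2 <= x ^+ d.
  have x1 : 1 - 2 * eta <= x by rewrite Ex; have := sqr_ge0 eta; lra.
  have : 1 - d%:R * (1 - x) <= x ^+ d.
    by apply: bernoulli_exprn; rewrite Ex sqr_ge0 expr_le1//; lra.
  apply: le_trans; rewrite lerD2l lerN2.
  apply: (@le_trans _ _ (d%:R * (2 * eta))); first by apply: ler_wpM2l => //; lra.
  rewrite /eta mulrA ler_pdivrMr//.
  have : eps * (4 * d%:R / eps) <= eps * r%:R by rewrite ler_pM2l.
  by rewrite mulrCA divff ?mulr1 ?gt_eqF//; lra.
apply: le_trans (all_bad_le eps d0 lam0 ell0 beta0 model S (r := r) M rN (ltW t0)) _.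
rewrite -expR_sum -expRD ler_expR sumrN -mulr_sumr.
set m1 := \sum_p mean _ _ _ _ _ in HM.
set m2 := \sum_p second _ _ _ _ _ in HS.
have -> : \sum_p (1 - mgf_bound ell beta S r theta (M := M) (Some p)) = theta * m1 - theta ^+ 2 * m2.
  rewrite /m1 /m2 !mulr_sumr -sumrB; apply: eq_bigr => p _ /=; ring.
have L0 : 0 < ell ^+ d by rewrite exprn_gt0.
have H1 : n%:R * (ell ^+ d * (1 - eps / 2)) <= (ell / r%:R) ^+ d * m1.
  apply: le_trans HM; apply: ler_wpM2l => //.
  by rewrite ler_pM2l.
have H2 : (ell / r%:R) ^+ d * m2 <= ell ^+ d * (n%:R * G0).
  by apply: le_trans HS _; rewrite ler_pM2l.
set D := (ell / r%:R) ^+ d in H1 H2 *.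
have lt0 : 0 < lam * theta by rewrite mulr_gt0.
have lt2 : 0 < lam * theta ^+ 2 by rewrite mulr_gt0// exprn_gt0.
have H1' := ler_wpM2l (ltW lt0) H1.
have H2' := ler_wpM2l (ltW lt2) H2.
have E : lam * ell ^+ d * eps ^+ 2 / (16 * G0) * n%:R =
  lam * theta * n%:R * ell ^+ d * (eps / 2) - lam * theta ^+ 2 * n%:R * ell ^+ d * G0.
  by rewrite /theta; field; rewrite gt_eqF.
rewrite E.
lra.
Qed.

End SkeletonBound.

(** * Union bound over skeletons *)

Section Escape.
Context {R : realType} {dT : measure_display} {T : measurableType dT}.
Variables (P : probability T R) (d : nat) (eps lam ell beta : R).
Variables (X : nat -> 'I_d -> T -> R) (W : nat -> 'I_d -> R -> T -> R).
Hypotheses (d0 : (0 < d)%N) (lam0 : 0 < lam) (ell0 : 0 < ell) (beta0 : 0 < beta).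
Hypothesis model : PPP_BM P lam X W.

Local Notation bd := (bad eps lam ell beta X W).
Local Notation K00' := (K00 eps lam ell beta X W).

(** [K00] in stages: the inductive predicate becomes a countable union, hence measurable. *)
Fixpoint reach m (c : cell d) : set T :=
  if m is m'.+1 then
    reach m' c `|` [set w | exists c', reach m' c' w /\ adjacent c' c /\ bd c w]
  else [set w | c = cell0 d /\ bd c w].

Lemma K00_reach w c : K00' w c <-> exists m, reach m c w.
Proof.
split=> [|[m]].
  elim=> [b0|c1 c2 _ [m Hm] a12 b2]; first by exists 0%N.
  by exists m.+1; right; exists c1.
elim: m c => [c [-> b0]|m IH c]; first exact: K00_base.
by case=> [/IH//|[c' [/IH Kc' [a b]]]]; exact: K00_step Kc' a b.
Qed.

(** Encoding of cells by finite functions, which form a countable type. *)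
Let cellf (z : {ffun 'I_d -> int} * nat) : cell d := (fun j => z.1 j, z.2).

Let cellf_surj c : exists z, cellf z = c.
Proof.
case: c => i m; exists ([ffun j => i j], m); rewrite /cellf; congr pair.
by apply/funext => j; rewrite ffunE.
Qed.

Lemma measurable_exists_cell (F : cell d -> set T) :
  (forall c, measurable (F c)) -> measurable [set w | exists c, F c w].
Proof.
move=> mF; rewrite (_ : [set w | _] = [set w | exists z, F (cellf z) w]).
  by apply: (countable_exists_measurable (F := fun z => F (cellf z))).
apply/seteqP; split=> w [c Fc]; last by exists (cellf c).
by have [z zc] := cellf_surj c; exists z; rewrite zc.
Qed.

Lemma measurable_propI (Q : Prop) (A : set T) : measurable A -> measurable [set w | Q /\ A w].
Proof.
move=> mA; have [q|nq] := pselect Q.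
  by rewrite (_ : [set w | _] = A)//; apply/seteqP; split=> w //= [].
by rewrite (_ : [set w | _] = set0)//; apply/seteqP; split=> w //= [].
Qed.

Lemma measurable_reach m c : measurable (reach m c).
Proof.
have mb c1 := measurable_bad eps ell beta0 model c1.
elim: m c => [|m IH] c /=; first exact: (measurable_propI (c = cell0 d) (mb c)).
apply: measurableU => //.
apply: (measurable_exists_cell (F := fun c' => [set w | reach m c' w /\ adjacent c' c /\ bd c w])).
by move=> c'; exact: (measurableI _ _ (IH c') (measurable_propI (adjacent c' c) (mb c))).
Qed.

Lemma measurable_escape t : measurable (escape_event eps lam ell beta X W t).
Proof.
apply: (measurable_exists_cell (F := fun c =>
  [set w | K00' w c /\ ~ (region ell beta c `<=` @Q R d t)])) => c.
rewrite (_ : [set w | _] = [set w | ~ (region ell beta c `<=` @Q R d t) /\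
    [set w | exists m, reach m c w] w]).
  apply: measurable_propI.
  by apply: (countable_exists_measurable (F := fun m => reach m c)) => m; exact: measurable_reach.
by apply/seteqP; split=> w /= [H1 H2]; split=> //; apply/K00_reach.
Qed.

Lemma K00_conn w c : K00' w c -> conn (fun c => bd c w) (cell0 d) c.
Proof.
elim=> [b0|c1 c2 _ IH a12 b2]; first exact: conn_refl.
exact: conn_step IH a12 b2.
Qed.

(** A cell within distance [L.-1] of the origin has its region in [-L ell, L ell]^d x [0, L beta];
    the last unit is the width of the cell. *)
Lemma escape_far (L : nat) t c : L%:R * ell < t ^+ 2 -> L%:R * beta < t / 2 ->
  ~ (region ell beta c `<=` @Q R d t) -> (L <= cdist (cell0 d) c)%N.
Proof.
move=> H1 H2 nreg; rewrite leqNgt; apply/negP => cL; apply: nreg.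
have /cdist_leP[Hi Ht] : (cdist (cell0 d) c <= L.-1)%N by lia.
move=> [x s] [/= Hx /andP[s1 s2]]; split=> [j|] /=.
  have := Hx j; move: (Hi j) => /= Hj /andP[x1 x2].
  have b1 : - L%:R <= (c.1 j)%:~R :> R.
    by rewrite -[L%:R]/(L%:~R) -intrN ler_int; lia.
  have b2 : (c.1 j + 1)%:~R <= L%:R :> R.
    by rewrite -[L%:R]/(L%:~R) ler_int; lia.
  have c1 : - L%:R * ell <= (c.1 j)%:~R * ell by rewrite ler_pM2r.
  have c2 : (c.1 j + 1)%:~R * ell <= L%:R * ell by rewrite ler_pM2r.
  by apply/andP; split; lra.
have b3 : c.2.+1%:R * beta <= L%:R * beta by rewrite ler_pM2r// ler_nat; move: Ht => /=; lia.
have b4 : 0 <= c.2%:R * beta by rewrite mulr_ge0// ltW.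
by apply/andP; split; lra.
Qed.

(** Union bound over the candidates that are [spread], for which the energy per cell is at most
    [G0]. *)
Lemma escape_le (g : nat -> nat) (k A : nat) (G0 t : R) :
  0 < eps < 1 -> (0 < A)%N -> (forall j, (0 < g j)%N) ->
  (forall j, (2 * (scale g j + g j + 1) + 1) ^ d.+1 <= A ^ j.+1)%N ->
  1 + \sum_(j < k) (2 ^ j)%:R * (corr_const d ell beta / Num.sqrt (g j).+1%:R) ^+ d <= G0 ->
  1 <= G0 ->
  (scale g k)%:R * ell < t ^+ 2 -> (scale g k)%:R * beta < t / 2 ->
  pr P (escape_event eps lam ell beta X W t) <=
  A%:R ^+ (2 * 2 ^ k) * expR (- (lam * ell ^+ d * eps ^+ 2 / (16 * G0) * (2 ^ k)%:R)).
Proof.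
move=> eps01 A0 g0 HA HG G1 t1 t2.
set e := expR _.
pose F (s : seq (cell d)) := all_bad eps lam ell beta X W (tnth (in_tuple s)).
have mF s : measurable (F s) by exact: (measurable_all_bad eps ell beta0 model).
pose L := [seq s <- emb g k (cell0 d) | `[< spread g k s >]].
apply: (@le_trans _ _ (\sum_(s <- L) pr P (F s))).
  apply: pr_exists_seq_le => //; first exact: measurable_escape.
  move=> w [c [/K00_conn cc /(escape_far t1 t2) far]].
  have [s [s1 s2 s3 _]] := conn_emb cc far; exists s.
    by rewrite mem_filter s1 andbT; apply/asboolP.
  by move=> i; apply: s3; exact: mem_tnth.
apply: (@le_trans _ _ (\sum_(s <- L) e)).
  rewrite big_seq [leRHS]big_seq; apply: ler_sum => s.
  rewrite mem_filter => /andP[/asboolP sp _].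
  rewrite /e -(spread_size sp); apply: skeleton_bad_le => //.
  have := spread_energy (rho := fun j => (corr_const d ell beta / Num.sqrt (g j).+1%:R) ^+ d)
    (@corrxx R d ell beta) _ sp.
  rewrite /energy big_tnth /=; under eq_bigr do rewrite big_tnth /=.
  move=> H; apply: le_trans (H _) _.
    (* Positivity of [g j] makes [(g j).+1] at least 2, as [corr_le] requires. *)
    move=> c c' j gc; apply: corr_le => //; apply/andP; split=> //.
    by rewrite ltnS; exact: g0.
  by rewrite (spread_size sp); apply: ler_wpM2l.
rewrite big_const_seq count_predT iter_addr addr0 -[leLHS]mulr_natl.
apply: ler_wpM2r; first exact: expR_ge0.
rewrite -natrX ler_nat; apply: (@leq_trans (size (emb g k (cell0 d)))).
  by rewrite size_filter count_size.
apply: leq_trans (size_emb _ _ HA) _.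
by rewrite leq_pexp2l// expnS; lia.
Qed.

End Escape.

(** * Choice of the gaps *)

Section GeometricBounds.
Context {R : realFieldType}.

Lemma sum_inv_sq_le k : \sum_(j < k) (j.+1%:R ^+ 2)^-1 <= 2 :> R.
Proof.
have H m : \sum_(j < m.+1) (j.+1%:R ^+ 2)^-1 <= 2 - m.+1%:R^-1 :> R.
  elim: m => [|m IH]; first by rewrite big_ord1 expr1n invr1; lra.
  rewrite big_ord_recr /=; apply: le_trans (lerD IH (lexx _)) _.
  rewrite -addrA lerD2l; set x : R := m.+1%:R.
  have x0 : 0 < x by rewrite ltr0n.
  have -> : m.+2%:R = x + 1 by rewrite /x natr1.
  have -> : - x^-1 + ((x + 1) ^+ 2)^-1 = - (x + 1)^-1 - (x * (x + 1) ^+ 2)^-1.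
    by field; rewrite !gt_eqF//; lra.
  by rewrite gerDl oppr_le0 invr_ge0 mulr_ge0 ?sqr_ge0// ltW.
case: k => [|k]; first by rewrite big_ord0.
by apply: le_trans (H k) _; rewrite gerDl oppr_le0 invr_ge0.
Qed.

Lemma sum_geom_le k : \sum_(j < k) (9 / 10) ^+ j <= 10 :> R.
Proof.
suff -> : \sum_(j < k) (9 / 10) ^+ j = 10 * (1 - (9 / 10) ^+ k) :> R.
  have : 0 <= (9 / 10) ^+ k :> R by apply: exprn_ge0; lra.
  by lra.
elim: k => [|k IH]; first by rewrite big_ord0 expr0; lra.
by rewrite big_ord_recr /= IH exprS; lra.
Qed.

Let step5 (Q : nat -> Prop) : Q 0%N -> Q 1%N -> Q 2%N -> Q 3%N -> Q 4%N ->
  (forall k, Q k -> Q (k + 5)%N) -> forall k, Q k.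
Proof.
move=> q0 q1 q2 q3 q4 H k.
have [m Hm] := ubnP k; elim: m k Hm => // m IH k Hm.
case: k Hm => [|[|[|[|[|k]]]]] Hm //.
by rewrite -[k.+1.+4]/(5 + k)%N addnC; apply/H/IH; lia.
Qed.

Let exp5 k : ((2 * (k + 5)) %/ 5).+1 = ((2 * k) %/ 5).+3.
Proof. by lia. Qed.

Let e5 : 1 / 2 <= (9 / 10) ^+ 5 :> R.
Proof. by rewrite !exprS expr0; lra. Qed.

(** Here 4^(2/5) is less than 2 times 9/10. The induction advances by 5, where the floor grows by
    exactly 2 and (9/10)^5 >= 1/2 suffices. *)
Lemma gap3_le k : 4 ^+ ((2 * k) %/ 5).+1 <= 4 * ((9 / 10) ^+ k * 2 ^+ k) :> R.
Proof.
elim/step5: k.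
- by rewrite (_ : (2 * 0 %/ 5)%N = 0%N)// !exprS !expr0; lra.
- by rewrite (_ : (2 * 1 %/ 5)%N = 0%N)// !exprS !expr0; lra.
- by rewrite (_ : (2 * 2 %/ 5)%N = 0%N)// !exprS !expr0; lra.
- by rewrite (_ : (2 * 3 %/ 5)%N = 1%N)// !exprS !expr0; lra.
- by rewrite (_ : (2 * 4 %/ 5)%N = 1%N)// !exprS !expr0; lra.
move=> k; rewrite exp5 !exprD [2 ^+ 5](_ : _ = 32); last by rewrite !exprS expr0; lra.
set m := ((2 * k) %/ 5)%N; rewrite [4 ^+ m.+3]exprS [4 ^+ m.+2]exprS.
set y := (9 / 10) ^+ k; set z := 2 ^+ k => IH.
have yz : 0 <= y * z by rewrite mulr_ge0 ?exprn_ge0//; lra.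
have := ler_wpM2l yz e5; set x := (9 / 10) ^+ 5.
rewrite (_ : 4 * (y * x * (z * 32)) = 128 * (y * z * x)); last by ring.
by lra.
Qed.

(** Here 8^(2/5) times 9/10 exceeds 2, and the extra 1 in the exponent pays for the floor. *)
Lemma gap3_ge k : 2 ^+ k <= 8 ^+ ((2 * k) %/ 5).+1 * (9 / 10) ^+ k :> R.
Proof.
elim/step5: k.
- by rewrite (_ : (2 * 0 %/ 5)%N = 0%N)// !exprS !expr0; lra.
- by rewrite (_ : (2 * 1 %/ 5)%N = 0%N)// !exprS !expr0; lra.
- by rewrite (_ : (2 * 2 %/ 5)%N = 0%N)// !exprS !expr0; lra.
- by rewrite (_ : (2 * 3 %/ 5)%N = 1%N)// !exprS !expr0; lra.
- by rewrite (_ : (2 * 4 %/ 5)%N = 1%N)// !exprS !expr0; lra.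
move=> k; rewrite exp5 !exprD [2 ^+ 5](_ : _ = 32); last by rewrite !exprS expr0; lra.
set m := ((2 * k) %/ 5)%N; rewrite [8 ^+ m.+3]exprS [8 ^+ m.+2]exprS.
set y := (9 / 10) ^+ k; set z := 2 ^+ k; set v := 8 ^+ m.+1 => IH.
have vy : 0 <= v * y by rewrite mulr_ge0 ?exprn_ge0//; lra.
have := ler_wpM2l vy e5; set x := (9 / 10) ^+ 5.
rewrite (_ : 8 * (8 * v) * (y * x) = 64 * (v * y * x)); last by ring.
by lra.
Qed.

End GeometricBounds.

(** Makes 2^j / (gap j)^(d/2) at most (j+1)^(-2) for d = 1, 2. For d >= 3 a growth 2^(a j) needs a >
    2/3 for summability in dimension 3 and a < 1 for radii of order 2^k; a = 4/5 fits, and powers of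
    4 have integral square roots. *)
Definition gap (d k : nat) : nat :=
  if d == 1%N then (4 ^ k * k.+1 ^ 4)%N
  else if d == 2%N then (2 ^ k * k.+1 ^ 2)%N
  else (4 ^ ((2 * k) %/ 5).+1)%N.

Lemma gap_gt0 d k : (0 < gap d k)%N.
Proof.
rewrite /gap; case: ifP => _; first by rewrite muln_gt0 !expn_gt0.
by case: ifP => _; rewrite ?muln_gt0 !expn_gt0.
Qed.

Definition scale_bound (d k : nat) : nat :=
  if d == 1%N then (4 ^ k * k.+1 ^ 4)%N
  else if d == 2%N then (2 ^ k * k.+1 ^ 3)%N
  else (21 * 2 ^ k)%N.

Lemma scale_le d k : (scale (gap d) k <= scale_bound d k)%N.
Proof.
rewrite /scale_bound; case: eqVneq => [->|d1].
  elim: k => // k IH; rewrite [scale _ _]/= {2}/gap eqxx [(4 ^ k.+1)%N]expnS -mulnA.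
  have : (1 <= 4 ^ k * k.+1 ^ 4)%N by rewrite muln_gt0 !expn_gt0.
  have : (4 ^ k * k.+1 ^ 4 <= 4 ^ k * k.+2 ^ 4)%N by rewrite leq_mul// leq_exp2r.
  move: IH; set u := (4 ^ k * k.+1 ^ 4)%N; set v := (4 ^ k * k.+2 ^ 4)%N; lia.
case: eqVneq => [->|d2].
  elim: k => // k IH; rewrite [scale _ _]/= {2}/gap /= [(2 ^ k.+1)%N]expnS -mulnA.
  have : (1 <= 2 ^ k * k.+1 ^ 2)%N by rewrite muln_gt0 !expn_gt0.
  have : (2 ^ k * (k.+1 ^ 3 + k.+1 ^ 2) <= 2 ^ k * k.+2 ^ 3)%N.
    by rewrite leq_mul// !expnS expn0; nia.
  move: IH; rewrite mulnDr; set u := (2 ^ k * k.+1 ^ 2)%N.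
  set v := (2 ^ k * k.+1 ^ 3)%N; set v' := (2 ^ k * k.+2 ^ 3)%N; lia.
(* The subtracted term absorbs the gaps, which are at most 4 (9/10)^k 2^k: doubling turns 20 into
   40, and 40 - 4 is 2 times 20 times 9/10. *)
suff : (scale (gap d) k)%:R + 1 <= 2 ^+ k * (21 - 20 * (9 / 10) ^+ k) :> rat.
  move=> H; rewrite -(ler_nat rat) natrM natrX.
  have : 0 <= 2 ^+ k * (9 / 10) ^+ k :> rat by rewrite mulr_ge0 ?exprn_ge0//; lra.
  by move: H; rewrite mulrBr; lra.
elim: k => [|k IH]; first by rewrite /= !expr0; lra.
have -> : (scale (gap d) k.+1)%:R = 2 * (scale (gap d) k)%:R + (gap d k)%:R + 1 :> rat.
  by rewrite -natrM -natrD natr1 /= addn1.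
rewrite {2}/gap (negbTE d1) (negbTE d2) natrX.
have := @gap3_le rat k; rewrite !exprS; move: IH; set y := (9 / 10) ^+ k; set z := 2 ^+ k.
set v := 4 ^+ _ => IH H3.
rewrite (_ : 2 * z * (21 - 20 * (9 / 10 * y)) = 42 * z - 36 * (y * z)); last by lra.
by lra.
Qed.

Lemma scale_bound_le d k : (scale_bound d k.+1 <= 64 ^ k.+1)%N.
Proof.
have k2 : (k.+2 <= 2 ^ k.+1)%N by exact: ltn_expl.
rewrite /scale_bound; case: ifP => _.
  rewrite -[64%N]/(4 * 16)%N expnMn leq_mul// -[16%N]/(2 ^ 4)%N -expnM mulnC expnM.
  by rewrite leq_exp2r.
case: ifP => _.
  rewrite (@leq_trans (2 ^ k.+1 * (2 ^ k.+1) ^ 3))//.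
    by rewrite leq_mul// leq_exp2r.
  by rewrite -!expnM -expnD -[64%N]/(2 ^ 6)%N -expnM leq_exp2l//; lia.
rewrite -[64%N]/(32 * 2)%N expnMn leq_mul//.
by rewrite (@leq_trans (32 ^ 1))// leq_exp2l.
Qed.

(** 256 is 4 times 64: the side of the ball is at most 4 times the next scale, which is at most
    64^(j+1). *)
Lemma scale_entropy d j :
  ((2 * (scale (gap d) j + gap d j + 1) + 1) ^ d.+1 <= (256 ^ d.+1) ^ j.+1)%N.
Proof.
rewrite -expnM [(d.+1 * j.+1)%N]mulnC expnM leq_exp2r//.
apply: (@leq_trans (4 * scale (gap d) j.+1)%N); first by rewrite [scale _ j.+1]/=; lia.
rewrite -[256%N]/(4 * 64)%N expnMn leq_mul//.
  by rewrite (@leq_trans (4 ^ 1)%N)// leq_exp2l.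
exact: leq_trans (scale_le _ _) (scale_bound_le _ _).
Qed.

Lemma scale_ge d k : (2 ^ k <= scale (gap d) k + 1)%N.
Proof. by elim: k => // k IH; rewrite [scale _ _]/= expnS; move: (gap_gt0 d k); lia. Qed.

Lemma gap_sum_le {R : rcfType} d k : (0 < d)%N ->
  \sum_(j < k) (2 ^ j)%:R * ((Num.sqrt (gap d j).+1%:R)^-1) ^+ d <= 10 :> R.
Proof.
move=> d0; pose s j : R := Num.sqrt (gap d j).+1%:R.
have s0 j : 0 < s j by rewrite sqrtr_gt0 ltr0n.
have sg j (v : nat) : (v ^ 2 <= gap d j)%N -> v%:R <= s j.
  move=> H; rewrite -[leLHS]ger0_norm// -sqrtr_sqr ler_sqrt//.
  by rewrite -natrX ler_nat (leq_trans H).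
have [E1|d1] := eqVneq d 1%N.
  apply: (@le_trans _ _ (\sum_(j < k) (j.+1%:R ^+ 2)^-1)); last first.
    by apply: le_trans (sum_inv_sq_le _) _; lra.
  apply: ler_sum => j _; rewrite {2}E1 expr1 -/(s j) ler_pdivrMr// mulrC.
  rewrite ler_pdivlMr ?exprn_gt0 ?ltr0n// -natrX -natrM; apply: sg.
  by rewrite /gap E1 eqxx expnMn -!expnM [(j * 2)%N]mulnC expnM.
have [E2|d2] := eqVneq d 2%N.
  apply: (@le_trans _ _ (\sum_(j < k) (j.+1%:R ^+ 2)^-1)); last first.
    by apply: le_trans (sum_inv_sq_le _) _; lra.
  apply: ler_sum => j _; rewrite {2}E2 exprVn sqr_sqrtr ?ler0n//.
  rewrite ler_pdivrMr ?ltr0n// mulrC ler_pdivlMr ?exprn_gt0 ?ltr0n//.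
  by rewrite -natrX -natrM ler_nat /gap E2 /=.
apply: le_trans (sum_geom_le k); apply: ler_sum => j _.
have h : (2 ^ ((2 * j) %/ 5).+1)%:R <= s j.
  by apply: sg; rewrite /gap (negbTE d1) (negbTE d2) -expnM mulnC expnM.
rewrite -/(s j).
have s1 : 1 <= s j by apply: le_trans h; rewrite ler1n expn_gt0.
(* Dimension 3 is the worst case, as [s j] is at least 1. *)
apply: (@le_trans _ _ ((2 ^ j)%:R * ((s j)^-1) ^+ 3)).
  apply: ler_wpM2l => //; apply: ler_wiXn2l; last by lia.
    by rewrite invr_ge0 ltW.
  by rewrite invf_le1.
rewrite exprVn ler_pdivrMr ?exprn_gt0// natrX mulrC.
apply: le_trans (gap3_ge j) _; apply: ler_wpM2r; first by apply: exprn_ge0; lra.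
rewrite (_ : 8 = 2 ^+ 3); last by rewrite !exprS expr0; lra.
by rewrite -exprM mulnC exprM lerXn2r ?nnegrE ?exprn_ge0 ?(ltW (s0 j))// -natrX.
Qed.

(** * Number of levels that fit into a given radius *)

Section Rate.
Context {R : realType}.
Variable d : nat.

Lemma scale_bracket (x : R) : 0 <= x ->
  exists k, (scale (gap d) k)%:R <= x < (scale (gap d) k.+1)%:R.
Proof.
move=> x0; have e0 : exists k, (scale (gap d) k <= Num.truncn x)%N by exists 0%N.
have ub k : (scale (gap d) k <= Num.truncn x)%N -> (k <= Num.truncn x)%N.
  move=> H; apply: leq_trans H.
  by have := leq_trans (@ltn_expl 2 k isT) (scale_ge d k); rewrite addn1 ltnS.
case: (ex_maxnP e0 ub) => k Hk Hmax; exists k; apply/andP; split.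
  by have /andP[tx _] := truncn_itv x0; apply: le_trans tx; rewrite ler_nat.
apply: lt_le_trans (truncnS_gt x) _; rewrite ler_nat ltnNge.
by apply/negP => /Hmax; rewrite ltnn.
Qed.

Lemma ln2_gt0 : 0 < ln 2 :> R.
Proof. by rewrite ln_gt0// ltr1n. Qed.

(** From 2^k <= t^2 one gets k <= (2 / ln 2) ln t; the added 2 gives a bound on k + 2, as ln t >=
    1. *)
Definition log_const : R := 2 / ln 2 + 2.

Lemma log_const_gt0 : 0 < log_const.
Proof. by rewrite /log_const addr_gt0// divr_gt0// ln2_gt0. Qed.

Lemma ln_ge1 (t : R) : expR 1 < t -> 1 <= ln t.
Proof.
move=> et; rewrite -[leLHS](expRK 1) ler_ln ?posrE ?expR_gt0//; first exact: ltW.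
exact: lt_trans (expR_gt0 _) et.
Qed.

Lemma scale_index_le (c1 t : R) k : 0 < c1 -> expR 1 < t -> c1 + 1 < t ->
  (scale (gap d) k)%:R <= c1 * t -> k.+2%:R <= log_const * ln t.
Proof.
move=> c0 et ct Hk; have l1 := ln_ge1 et.
have t1 : 1 < t by lra.
have t0 : 0 < t by lra.
have H2 : 2 ^+ k <= t ^+ 2.
  have : (2 ^ k)%:R <= (scale (gap d) k)%:R + 1 :> R.
    by have := scale_ge d k; rewrite addn1 natr1 ler_nat.
  have : (c1 + 1) * t <= t * t by rewrite ler_pM2r// ltW.
  by rewrite natrX [t ^+ 2]expr2; lra.
have : k%:R * ln 2 <= 2 * ln t.
  have : ln (2 ^+ k) <= ln (t ^+ 2) by rewrite ler_ln ?posrE ?exprn_gt0.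
  by rewrite !lnXn// !mulr_natl.
rewrite -ler_pdivlMr ?ln2_gt0// => H.
rewrite /log_const mulrDl -addn2 natrD.
have : 2 * ln t / ln 2 = 2 / ln 2 * ln t by rewrite mulrAC.
by lra.
Qed.

(** The scale that exceeds the radius is that of level k + 1, hence the factors 2 and 42, twice
    21. *)
Definition rate_const (c1 : R) : R :=
  if d == 1%N then Num.sqrt c1 / (2 * log_const ^+ 4)
  else if d == 2%N then c1 / (2 * log_const ^+ 4) else c1 / 42.

(** Dimension 1 needs the power 2 of the logarithm and dimension 2 the power 3; the power 4 covers
    both with one exponent. *)
Definition rate (t : R) : R :=
  if d == 1%N then Num.sqrt t / (ln t) `^ 4
  else if d == 2%N then t / (ln t) `^ 4 else t.

Lemma rate_const_gt0 c1 : 0 < c1 -> 0 < rate_const c1.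
Proof.
move=> c0; have l0 := log_const_gt0; rewrite /rate_const.
have l4 : 0 < 2 * log_const ^+ 4 by rewrite mulr_gt0// exprn_gt0.
by do 2 (case: ifP => _; first by rewrite divr_gt0// sqrtr_gt0); rewrite divr_gt0.
Qed.

(** For the last [k] whose scale fits into c1 t, level k + 1 overshoots; its [scale_bound] is solved
    for 2^k after bounding k + 2 by a multiple of ln t. *)
Lemma rate_le (c1 t : R) : 0 < c1 -> expR 1 < t -> c1 + 1 < t ->
  exists2 k, (scale (gap d) k)%:R <= c1 * t & rate_const c1 * rate t <= (2 ^ k)%:R.
Proof.
move=> c0 et ct; have l1 := ln_ge1 et; have t0 : 0 < t by lra.
have ct0 : 0 < c1 * t by rewrite mulr_gt0.
have [k /andP[Hk Hk1]] := scale_bracket (ltW ct0).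
exists k => //; have Hl := scale_index_le c0 et ct Hk.
have lc0 := log_const_gt0.
have {}Hk1 : c1 * t < (scale_bound d k.+1)%:R.
  by apply: lt_le_trans Hk1 _; rewrite ler_nat scale_le.
have k1 : 1 <= k.+2%:R :> R by rewrite ler1n.
have K4 : k.+2%:R ^+ 4 <= log_const ^+ 4 * (ln t) ^+ 4.
  by rewrite -exprMn lerXn2r ?nnegrE// mulr_ge0; lra.
have ln4 : 0 < ln t ^+ 4 by rewrite exprn_gt0//; lra.
have lc4 : 0 < log_const ^+ 4 by rewrite exprn_gt0.
have pw : ln t `^ 4 = ln t ^+ 4 by rewrite -powR_mulrn//; lra.
have mon (m : nat) : (m <= 4)%N -> k.+2%:R ^+ m <= log_const ^+ 4 * (ln t) ^+ 4.
  by move=> m4; apply: le_trans K4; apply: ler_weXn2l.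
move: Hk1; rewrite /rate_const /rate /scale_bound pw; case: ifP => _.
  move=> H; have : Num.sqrt (c1 * t) <= (2 ^ k.+1 * k.+2 ^ 2)%:R.
    rewrite -[leRHS]ger0_norm// -sqrtr_sqr ler_sqrt// ?sqr_ge0//; apply/ltW.
    apply: lt_le_trans H _; rewrite -natrX ler_nat expnMn -!expnM.
    by rewrite [(k.+1 * 2)%N]mulnC expnM.
  rewrite sqrtrM ?(ltW c0)// natrM expnS natrM !natrX.
  have := ler_wpM2l (ler0n R (2 ^ k)) (mon 2%N isT); rewrite natrX.
  set a := Num.sqrt c1; set b := Num.sqrt t; set z := 2 ^+ k; set y := k.+2%:R ^+ 2.
  set L := log_const ^+ 4 in lc4 *; set l := ln t ^+ 4 in ln4 * => H1 H2.
  have p : 0 < 2 * L * l by apply: mulr_gt0 => //; exact: mulr_gt0.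
  have -> : a / (2 * L) * (b / l) = a * b / (2 * L * l) by field; rewrite !gt_eqF.
  by rewrite ler_pdivrMr//; lra.
case: ifP => _.
  rewrite natrM expnS natrM !natrX => H.
  have := ler_wpM2l (ler0n R (2 ^ k)) (mon 3%N isT); rewrite natrX.
  set z := 2 ^+ k in H *; set y := k.+2%:R ^+ 3 in H *.
  set L := log_const ^+ 4 in lc4 *; set l := ln t ^+ 4 in ln4 * => H1.
  have p : 0 < 2 * L * l by apply: mulr_gt0 => //; exact: mulr_gt0.
  have -> : c1 / (2 * L) * (t / l) = c1 * t / (2 * L * l) by field; rewrite !gt_eqF.
  by rewrite ler_pdivrMr//; lra.
by rewrite natrM expnS natrM; lra.
Qed.

End Rate.

Theorem theorem1p2 (R : realType) (d : nat) : (1 <= d)%N ->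
  exists c : R, 0 < c /\
  forall eps ell beta : R, 0 < eps < 1 -> 0 < ell -> 0 < beta ->
  exists C lam0 t0 : R, [/\ 0 < C, 0 < lam0 & 0 < t0] /\
  forall lam t : R, lam0 < lam -> t0 < t ->
  forall (dT : measure_display) (T : measurableType dT) (P : probability T R)
         (X : nat -> 'I_d -> T -> R) (W : nat -> 'I_d -> R -> T -> R),
    PPP_BM P lam X W ->
    (P (escape_event eps lam ell beta X W t) <=
      (if d == 1%N then expR (- C * (Num.sqrt t / (ln t) `^ c))
       else if d == 2%N then expR (- C * (t / (ln t) `^ c))
       else expR (- C * t))%:E)%E.
Proof.
move=> d0; exists 4; split=> // eps ell beta eps01 ell0 beta0.
have [eps0 eps1] := andP eps01.
pose kappa := corr_const d ell beta.
have k0 : 0 <= kappa.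
  by rewrite /kappa /corr_const addr_ge0 ?mulr_ge0 ?sqrtr_ge0 ?invr_ge0 ?sqrtr_ge0// ltW.
have kd0 : 0 <= kappa ^+ d by exact: exprn_ge0.
pose G0 := 1 + kappa ^+ d * 10.
have G1 : 1 <= G0 by rewrite /G0; lra.
have [A A0 EA] : exists2 A : nat, (0 < A)%N & A = (256 ^ d.+1)%N.
  by exists (256 ^ d.+1)%N; rewrite // expn_gt0.
have AR : 0 < A%:R :> R by rewrite ltr0n.
have lA : 0 <= ln A%:R :> R by rewrite ln_ge0// ler1n.
(* A radius of at most c1 t lasts at most t / 4 in time. Time is the binding constraint: for large t
   the spatial extent t^2 exceeds c1 t ell. *)
pose c1 := (4 * beta)^-1.
have c0 : 0 < c1 by rewrite invr_gt0 mulr_gt0.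
pose D := ell ^+ d * eps ^+ 2 / (16 * G0).
have D0 : 0 < D by rewrite divr_gt0 ?mulr_gt0 ?exprn_gt0//; lra.
(* The threshold on [lam] makes lam D exceed the entropy 2 ln A by 1, which leaves exp (-2^k). The
   summands of the threshold on [t] give ln t >= 1, the logarithmic bound on k, and c1 t ell <
   t^2. *)
exists (rate_const d c1), ((2 * ln A%:R + 1) / D), (expR 1 + (c1 + 1) + c1 * ell).
have ce0 : 0 < c1 * ell by rewrite mulr_gt0.
have e0 := expR_gt0 (1 : R).
split; first split.
- exact: rate_const_gt0.
- by rewrite divr_gt0//; lra.
- by lra.
move=> lam t Hlam Ht dT T P X W model.
have lam0 : 0 < lam.
  by apply: lt_trans Hlam; rewrite divr_gt0//; lra.
have t0 : 0 < t by lra.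
have [k Hk Hrate] : exists2 k, (scale (gap d) k)%:R <= c1 * t &
    rate_const d c1 * rate d t <= (2 ^ k)%:R by apply: rate_le => //; lra.
have -> : (if d == 1%N then expR (- rate_const d c1 * (Num.sqrt t / ln t `^ 4))
       else if d == 2%N then expR (- rate_const d c1 * (t / ln t `^ 4))
       else expR (- rate_const d c1 * t)) = expR (- (rate_const d c1 * rate d t)).
  by rewrite /rate; case: ifP => _; [|case: ifP => _]; rewrite mulNr.
rewrite prE; last exact: (measurable_escape eps ell beta0 model).
rewrite lee_fin; apply: (@le_trans _ _ (expR (- (2 ^ k)%:R))); last first.
  by rewrite ler_expR lerN2.
have := @escape_le R dT T P d eps lam ell beta X W d0 lam0 ell0 beta0 model (gap d) k A G0 t
  eps01 A0 (gap_gt0 d).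
move=> H; apply: le_trans (H _ _ G1 _ _) _.
- by move=> j; rewrite EA; exact: scale_entropy.
- rewrite /G0 lerD2l.
  apply: (@le_trans _ _ (kappa ^+ d * \sum_(j < k) (2 ^ j)%:R *
     ((Num.sqrt (gap d j).+1%:R)^-1) ^+ d)).
    by rewrite mulr_sumr le_eqVlt; apply/orP; left; apply/eqP/eq_bigr => j _;
      rewrite -/kappa exprMn mulrCA.
  by apply: ler_wpM2l => //; exact: gap_sum_le.
- apply: (@le_lt_trans _ _ (c1 * t * ell)); first by rewrite ler_pM2r.
  by rewrite mulrAC expr2 ltr_pM2r//; lra.
- apply: (@le_lt_trans _ _ (c1 * t * beta)); first by rewrite ler_pM2r.
  have -> : c1 * t * beta = t / 4 by rewrite /c1; field; rewrite gt_eqF.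
  by lra.
rewrite -[A%:R]lnK ?posrE// -expRM_natl -expRD ler_expR.
rewrite natrM; set z := (2 ^ k)%:R.
have z0 : 0 <= z by exact: ler0n.
have E : lam * ell ^+ d * eps ^+ 2 / (16 * G0) = lam * D by rewrite /D !mulrA.
have HD : (2 * ln A%:R + 1) <= lam * D by rewrite -ler_pdivrMr// ltW.
have := ler_wpM2r z0 HD; rewrite E.
lra.
Qed.
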